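(* Let $l$ denote an open curve in 3-space. The double alternating self-linking integral $SLL(l)$ is a continuous function of the coordinates of $l$.
   Context: Curves are simple (without self-intersections). For a curve $l$ with parametrization $\gamma:[0,1]\to\mathbb{R}^3$, $$SLL(l)=\frac{1}{8\pi}\int_{\vec\xi\in S^2}\ \sum_{(j_1,j_2,j_3,j_4)\in I_{\vec\xi}^*}\epsilon(j_1,j_3)\,\epsilon(j_2,j_4)\,dA,$$ where $\epsilon(s,t)=\pm1$ is the sign of the crossing between the projections of $\gamma(s)$ and $\gamma(t)$, and $I_{\vec\xi}^*$ is the set of 4-tuples $j_1>j_2>j_3>j_4$ of alternating crossings in the projection of $l$ to the plane with normal vector $\vec\xi$: $j_1,j_3$ are the two passages through one crossing, $j_2,j_4$ are the two passages through another crossing, and $j_1$ belongs to the over-arc of its crossing while $j_2$ belongs to the under-arc of its crossing, or vice versa. The integral omits the measure-zero set of non-generic projection directions. For a polygonal curve the coordinates are those of its vertices. *)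

(* Defs.v *)
From HB Require Import structures.
From mathcomp Require Import all_boot all_order all_algebra.
From mathcomp Require Import all_classical all_reals all_analysis.

Set Implicit Arguments.
Unset Strict Implicit.
Unset Printing Implicit Defensive.

Import Order.TTheory GRing.Theory Num.Theory.
Import numFieldNormedType.Exports.

Local Open Scope classical_set_scope.
Local Open Scope ring_scope.

Definition dot (R : realType) (u v : 'rV[R]_3) : R := \sum_i u 0 i * v 0 i.

(* The mixed product (u x v) . w. *)
Definition det3 (R : realType) (u v w : 'rV[R]_3) : R :=
  \det (\matrix_(i < 3) [tuple u; v; w]`_i).

(* A curve is given by a parametrization g : R -> R^3 of which only the
   restriction to [0, 1] matters; "open" means that the endpoints differ,
   which injectivity on the closed interval includes. *)
Definition simple_open_curve (R : realType) (g : R -> 'rV[R]_3) : Prop :=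
  set_inj `[0, 1] g.

(* Orthogonal projection to the plane with unit normal vector xi. *)
Definition proj (R : realType) (xi x : 'rV[R]_3) : 'rV[R]_3 :=
  x - dot x xi *: xi.

(* g s and g t are the two passages through a multiple point of the
   projection of g along xi. *)
Definition crossing (R : realType) (g : R -> 'rV[R]_3) (xi : 'rV[R]_3)
    (s t : R) : Prop :=
  [/\ 0 <= s <= 1, 0 <= t <= 1, s != t & proj xi (g s) = proj xi (g t)].

(* The projection is viewed from the side xi points to. *)
Definition over (R : realType) (g : R -> 'rV[R]_3) (xi : 'rV[R]_3)
    (s t : R) : bool :=
  dot (g t) xi < dot (g s) xi.

(* +1 when the tangent of the over-arc followed by the tangent of the
   under-arc is a positive frame of the plane oriented by xi, and -1 when it
   is a negative one: the mixed product with xi is the same for the tangents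
   and for their projections. *)
Definition crossing_sign (R : realType) (g : R -> 'rV[R]_3) (xi : 'rV[R]_3)
    (s t : R) : R :=
  if over g xi s t then Num.sg (det3 (derive1 g s) (derive1 g t) xi)
  else Num.sg (det3 (derive1 g t) (derive1 g s) xi).

(* The projection of g along xi has finitely many multiple points, all of them
   transversal double points at which both passages have a tangent and neither
   is an endpoint of g.  As crossing is symmetric, the second clause applies to
   both passages.  For a polygonal curve this rules out the directions parallel
   to an edge and those for which a corner projects onto another point. *)
Definition generic (R : realType) (g : R -> 'rV[R]_3) (xi : 'rV[R]_3) : Prop :=
  [/\ finite_set [set st : R * R | crossing g xi st.1 st.2],
      forall s t, crossing g xi s t -> 0 < s < 1 /\ derivable g s 1,
      forall s t, crossing g xi s t -> det3 (derive1 g s) (derive1 g t) xi != 0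
    & forall s t u, crossing g xi s t -> crossing g xi s u -> t = u].

Definition alternating (R : realType) (g : R -> 'rV[R]_3) (xi : 'rV[R]_3) :
    set (R * R * R * R) :=
  [set j | let: (j1, j2, j3, j4) := j in
    [/\ [/\ j4 < j3, j3 < j2 & j2 < j1],
        crossing g xi j1 j3, crossing g xi j2 j4
      & (over g xi j1 j3 /\ over g xi j4 j2) \/
        (over g xi j3 j1 /\ over g xi j2 j4)]].

(* A finite sum for generic xi. *)
Definition alternating_sum (R : realType) (g : R -> 'rV[R]_3)
    (xi : 'rV[R]_3) : R :=
  \sum_(j \in alternating g xi)
    (let: (j1, j2, j3, j4) := j in
     crossing_sign g xi j1 j3 * crossing_sign g xi j2 j4).

(* Spherical coordinates: longitude a.1, colatitude a.2. *)
Definition sphere_point (R : realType) (a : R * R) : 'rV[R]_3 :=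
  \row_(i < 3) [tuple sin a.2 * cos a.1; sin a.2 * sin a.1; cos a.2]`_i.

(* Integral over A, a subset of the unit sphere, with respect to the area
   element dA = sin(a.2) da.1 da.2. *)
Definition sphere_integral (R : realType) (A : set 'rV[R]_3)
    (f : 'rV[R]_3 -> R) : R :=
  (\int[(lebesgue_measure \x lebesgue_measure)%E]_(a in
     (`[0, 2 * pi] `*` `[0, pi]) `&` (@sphere_point R @^-1` A))
       (f (sphere_point a) * sin a.2))%R.

Definition SLL (R : realType) (g : R -> 'rV[R]_3) : R :=
  (8 * pi)^-1 * sphere_integral [set xi | generic g xi] (alternating_sum g).

(* The polygonal curve with n.+1 edges whose successive vertices are the rows
   of V, each edge being run through affinely in time n.+1^-1.  At t = 1 the
   out-of-range row has coefficient 0, so that the value is the last vertex. *)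
Definition polygonal (R : realType) (n : nat) (V : 'M[R]_(n.+2, 3)) (t : R) :
    'rV[R]_3 :=
  let x := n.+1%:R * t in
  let e := Num.truncn x in
  let r := x - e%:R in
  (1 - r) *: row (inord e) V + r *: row (inord e.+1) V.

(* Main.v *)
Require Import Defs.
From HB Require Import structures.
From mathcomp Require Import all_boot all_order all_algebra.
From mathcomp Require Import all_classical all_reals all_analysis.
From mathcomp Require Import measurable_realfun.
From mathcomp Require Import ring lra.

(** For a direction [xi] in which the projection of a polygon is in general
    position, a small change of the vertices or of [xi] moves the crossings of
    the projection but changes neither which edges cross, nor which of the two
    passes over, nor the sign, nor the order of the passages along the curve.
    The alternating sum is therefore locally constant there, jointly in the
    vertices and in the direction, and the theorem follows by dominated
    convergence.

    General position is expressed by [regular], a condition on pairs of edges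
    and triples of edges which implies genericity ([regular_generic]) and is
    open by design ([near_regular]): each of its clauses either bounds a
    continuous function away from zero on a compact set of parameters or
    compares continuous functions strictly.  Cramer's rule ([proj_lines_meet])
    gives the parameters of a crossing as quotients of determinants, so that
    the alternating sum becomes a finite sum over quadruples of edges whose
    conditions are strict inequalities between continuous functions
    ([alternating_sumE], [near_eq_edge_alternating_sum]).  The number of
    quadruples bounds the sum uniformly.

    A simple polygon has almost every direction regular ([ae_regular]).  The
    exceptional directions lie on finitely many great circles, except for those
    with a triple point: three pairwise skew lines are met by the generators of
    a quadric, whose directions sweep out the zero set of a quadratic form.
    The zero set of a nonzero quadratic form on the sphere is null
    ([ae_quadratic], by Fubini: on each meridian the form becomes a binary form
    in sine and cosine).  The forms must be shown not to vanish identically,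
    and this is where simplicity enters: if the form attached to three edges
    were zero, then a single triple point would make two of the edges
    intersect in space ([ae_no_triple_point]).

    The set of generic directions need not be measurable a priori.  As it
    contains the open set of regular directions, whose complement is null,
    both give the same integral ([integral_domain_off_null]), and the integrand
    on regular directions is measurable because it is locally constant times a
    sine. *)

Set Implicit Arguments.
Unset Strict Implicit.
Unset Printing Implicit Defensive.

Import Order.TTheory GRing.Theory Num.Theory.
Import numFieldNormedType.Exports.

Local Open Scope classical_set_scope.
Local Open Scope ring_scope.

(* Unqualified, the name denotes the coordinate maps of a product topology. *)
Local Notation proj := Defs.proj.
Local Notation angle_measure := (lebesgue_measure \x lebesgue_measure)%E.

(** * Determinants and projections in space *)

Section Vectors.
Variable R : realType.
Implicit Types u v w xi : 'rV[R]_3.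

Lemma dotE u v : dot u v = u 0 0 * v 0 0 + u 0 1 * v 0 1 + u 0 2%:R * v 0 2%:R.
Proof.
rewrite /dot !big_ord_recr big_ord0 /= add0r.
by congr (_ * _ + _ * _ + _ * _); congr (_ _ _); apply/val_inj.
Qed.

Lemma det3E u v w : det3 u v w =
  u 0 0 * (v 0 1 * w 0 2%:R - v 0 2%:R * w 0 1)
  - u 0 1 * (v 0 0 * w 0 2%:R - v 0 2%:R * w 0 0)
  + u 0 2%:R * (v 0 0 * w 0 1 - v 0 1 * w 0 0).
Proof.
rewrite /det3 (expand_det_row _ 0) !big_ord_recr big_ord0 /= add0r /cofactor.
rewrite !(expand_det_row _ 0) !big_ord_recr !big_ord0 /= !add0r /cofactor.
rewrite !det_mx11 !mxE /=.
(* Entries are read by numerical index, so that the ordinals produced by the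
   two cofactor expansions become comparable by computation. *)
have [f E] : exists f : 'rV[R]_3 -> nat -> R,
    forall (z : 'rV_3) (j : 'I_3), z 0 j = f z j.
  by exists (fun z k => z 0 (inord k)) => z j; rewrite inord_val.
rewrite !E /= /bump /=; ring.
Qed.

Lemma row3P u v : u 0 0 = v 0 0 -> u 0 1 = v 0 1 -> u 0 2%:R = v 0 2%:R -> u = v.
Proof.
move=> e0 e1 e2; apply/rowP => -[[|[|[|//]]] lti].
- by rewrite (_ : Ordinal lti = 0) //; apply/val_inj.
- by rewrite (_ : Ordinal lti = 1) //; apply/val_inj.
- by rewrite (_ : Ordinal lti = 2%:R) //; apply/val_inj.
Qed.

Lemma cramer3 u a b c : det3 a b c *: u =
  det3 u b c *: a + det3 a u c *: b + det3 a b u *: c.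
Proof. by apply: row3P; rewrite !mxE !det3E; ring. Qed.

Lemma projB xi u v : proj xi (u - v) = proj xi u - proj xi v.
Proof. by apply/rowP => j; rewrite !mxE !dotE !mxE; ring. Qed.

Lemma projZ xi c u : proj xi (c *: u) = c *: proj xi u.
Proof. by apply/rowP => j; rewrite !mxE !dotE !mxE; ring. Qed.

Lemma proj_eq0 xi u : proj xi u = 0 -> u = dot u xi *: xi.
Proof. by move=> /eqP; rewrite /proj subr_eq0 => /eqP. Qed.

Lemma proj_colinear xi c : dot xi xi = 1 -> proj xi (c *: xi) = 0.
Proof.
move=> xi1; rewrite /proj (_ : dot _ xi = c) ?subrr//.
by rewrite -[RHS]mulr1 -xi1 !dotE !mxE; ring.
Qed.

End Vectors.

(** * Coordinatewise continuity *)

Section Continuity.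
Variables (R : realType) (Z : topologicalType).
Implicit Types (f g h : Z -> 'rV[R]_3) (z : Z) (p q : Z -> R).

(** Everything is built from finitely many real polynomial expressions in the
    entries, for which continuity of the entries is the usable notion. *)
Definition coord_cont f z := forall j, {for z, continuous (fun y => f y 0 j)}.

Lemma coord_contD f g z : coord_cont f z -> coord_cont g z ->
  coord_cont (fun y => f y + g y) z.
Proof.
move=> cf cg j; rewrite (_ : (fun y => _) = fun y => f y 0 j + g y 0 j).
  exact: cvgD (cf j) (cg j).
by apply/funext => y; rewrite mxE.
Qed.

Lemma coord_contN f z : coord_cont f z -> coord_cont (fun y => - f y) z.
Proof.
move=> cf j; rewrite (_ : (fun y => _) = fun y => - f y 0 j).
  exact: cvgN (cf j).
by apply/funext => y; rewrite mxE.
Qed.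

Lemma coord_contB f g z : coord_cont f z -> coord_cont g z ->
  coord_cont (fun y => f y - g y) z.
Proof. by move=> cf cg; apply: coord_contD => //; exact: coord_contN. Qed.

Lemma coord_contZ p f z : {for z, continuous p} -> coord_cont f z ->
  coord_cont (fun y => p y *: f y) z.
Proof.
move=> cp cf j; rewrite (_ : (fun y => _) = fun y => p y * f y 0 j).
  exact: cvgM cp (cf j).
by apply/funext => y; rewrite mxE.
Qed.

Lemma cont_dot f g z : coord_cont f z -> coord_cont g z ->
  {for z, continuous (fun y => dot (f y) (g y))}.
Proof.
move=> cf cg; rewrite (funext (fun y => dotE (f y) (g y))).
by apply: cvgD; [apply: cvgD|]; apply: cvgM; do [exact: cf | exact: cg].
Qed.

Lemma cont_det3 f g h z : coord_cont f z -> coord_cont g z -> coord_cont h z ->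
  {for z, continuous (fun y => det3 (f y) (g y) (h y))}.
Proof.
move=> cf cg ch; rewrite (funext (fun y => det3E (f y) (g y) (h y))).
by apply: cvgD; [apply: cvgB|]; apply: cvgM;
  try (apply: cvgB; apply: cvgM); do [exact: cf | exact: cg | exact: ch].
Qed.

Lemma coord_cont_proj f g z : coord_cont f z -> coord_cont g z ->
  coord_cont (fun y => proj (f y) (g y)) z.
Proof.
move=> cf cg; apply: coord_contB => //; apply: coord_contZ => //.
exact: cont_dot.
Qed.

Lemma coord_cont_neq0 f z : coord_cont f z -> f z != 0 ->
  \forall y \near z, f y != 0.
Proof.
move=> cf fz; have [j fj] : exists j, f z 0 j != 0.
  apply: contrapT => nj; case/eqP: fz; apply/rowP => j; rewrite mxE.
  by apply: contrapT => /eqP fj; apply: nj; exists j.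
have : \forall y \near z, f y 0 j != 0 by exact: cvgr_neq0 (cf j) fj.
by apply: filterS => y; apply: contra_neq => ->; rewrite mxE.
Qed.

Lemma near_ltr p q z : {for z, continuous p} -> {for z, continuous q} ->
  p z < q z -> \forall y \near z, p y < q y.
Proof.
move=> cp cq pq; have cpq : {for z, continuous (fun y => q y - p y)}.
  exact: cvgB.
have : \forall y \near z, 0 < q y - p y.
  by apply: cvgr_gt cpq _ _; rewrite subr_gt0.
by apply: filterS => y; rewrite subr_gt0.
Qed.

Lemma near_eq_ltr p q z : {for z, continuous p} -> {for z, continuous q} ->
  p z != q z -> \forall y \near z, (p y < q y) = (p z < q z).
Proof.
move=> cp cq; case: ltgtP => // pq _.
- by have := near_ltr cp cq pq; apply: filterS => y ->.
- by have := near_ltr cq cp pq; apply: filterS => y /ltW; rewrite leNgt => /negbTE.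
Qed.

Lemma near_eq_sg p z : {for z, continuous p} -> p z != 0 ->
  \forall y \near z, Num.sg (p y) = Num.sg (p z).
Proof.
move=> cp; case: ltgtP => // pz _.
- have := near_ltr cp (@cst_continuous _ _ (0 : R) z) pz.
  by apply: filterS => y; rewrite (ltr0_sg pz) => /ltr0_sg.
- have := near_ltr (@cst_continuous _ _ (0 : R) z) cp pz.
  by apply: filterS => y; rewrite (gtr0_sg pz) => /gtr0_sg.
Qed.

End Continuity.

(** Compactness makes the neighbourhood uniform in [x].  This is how the absence
    of a crossing is seen to persist even next to parallel edges, where
    Cramer's rule degenerates. *)
Lemma near_compact_neq0 (R : realType) (Z X : topologicalType) (K : set X)
    (f : Z * X -> 'rV[R]_3) (z : Z) : compact K ->
  (forall x, K x -> coord_cont f (z, x)) -> (forall x, K x -> f (z, x) != 0) ->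
  \forall y \near z, forall x, K x -> f (y, x) != 0.
Proof.
move=> /compact_near_coveringP cK cf f0.
apply: (cK _ (nbhs z) (fun y x => f (y, x) != 0)) => x Kx.
have := coord_cont_neq0 (cf x Kx) (f0 x Kx).
move=> -[[A B] /= [zA xB] AB]; exists (B, A) => //= -[x' y] /= [Bx' Ay].
exact: AB.
Qed.

(** * Polygonal curves edge by edge *)

Section PolygonalCurve.
Variables (R : realType) (n : nat).
Implicit Types (V : 'M[R]_(n.+2, 3)) (i j : 'I_n.+1) (r s t : R).

Definition edge V (k : nat) := row (inord k.+1) V - row (inord k) V.

Definition edge_pt V (k : nat) r := row (inord k) V + r *: edge V k.

Definition edge_time (k : nat) r : R := (k%:R + r) / n.+1%:R.

Lemma edge_time_itv i r : 0 <= r <= 1 -> 0 <= edge_time i r <= 1.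
Proof.
move=> /andP[r0 r1]; rewrite /edge_time divr_ge0 ?addr_ge0//=.
rewrite ler_pdivrMr ?ltr0n// mul1r; have := ltn_ord i.
by rewrite -(ler_nat R) -natr1; lra.
Qed.

Lemma edge_time_oo i r : 0 < r < 1 -> 0 < edge_time i r < 1.
Proof.
move=> /andP[r0 r1]; rewrite /edge_time divr_gt0 ?ltr_wpDl//=.
rewrite ltr_pdivrMr ?ltr0n// mul1r; have := ltn_ord i.
by rewrite -(ler_nat R) -natr1; lra.
Qed.

(** A vertex between two edges has two descriptions; the final time is only
    reached as the end of the last edge, hence the closed interval for [r]. *)
Lemma edge_timeP t : 0 <= t <= 1 ->
  exists i r, [/\ 0 <= r <= 1 & t = edge_time i r].
Proof.
move=> /andP[t0 t1]; set x := n.+1%:R * t.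
have x0 : 0 <= x by rewrite mulr_ge0.
have [xn|nx] := ltP x n.+1%:R.
  have /andP[ex xe] := truncn_itv x0.
  have en : (Num.truncn x < n.+1)%N by rewrite truncn_lt_nat.
  exists (Ordinal en), (x - (Num.truncn x)%:R); split.
    by move: xe; rewrite -natr1 => xe; apply/andP; split; lra.
  by rewrite /edge_time /= addrC subrK /x mulrC mulKf.
(* Here [t = 1]. *)
exists ord_max, 1; split; first by rewrite ler01 lexx.
rewrite /edge_time natr1 divff//; apply/eqP; rewrite eq_le t1 /=.
by move: nx; rewrite /x ler_pMr.
Qed.

Lemma edge_time_eq (k l : nat) r s :
  edge_time k r = edge_time l s -> k%:R + r = l%:R + s.
Proof. by apply: mulIf; rewrite invr_eq0 pnatr_eq0. Qed.

(** Only vertices have two descriptions, so one interior parameter suffices. *)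
Lemma edge_time_inj i j r s : 0 < r < 1 -> 0 <= s <= 1 ->
  edge_time i r = edge_time j s -> i = j /\ r = s.
Proof.
move=> r01 s01 /edge_time_eq e.
have ij : i = j.
  apply/val_inj => /=; case: (ltngtP i j) => //.
  - by move=> ij; exfalso; move: ij; rewrite -(ler_nat R) -natr1; lra.
  - by move=> ji; exfalso; move: ji; rewrite -(ler_nat R) -natr1; lra.
by split=> //; move: e; rewrite ij => /addrI.
Qed.

Lemma polygonal_edge_time V i r : 0 <= r <= 1 ->
  polygonal V (edge_time i r) = edge_pt V i r.
Proof.
move=> /andP[r0 r1]; rewrite /polygonal /edge_time mulrC divfK ?pnatr_eq0//.
have [->|rN1] := eqVneq r 1.
  (* The end of an edge is computed as the beginning of the next one. *)
  rewrite natr1 natrK subrr subr0 scale0r addr0 !scale1r /edge_pt scale1r.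
  by rewrite /edge addrC subrK.
have -> : Num.truncn (i%:R + r) = i.
  by apply: truncn_def; rewrite lerDl r0 -natr1 ltrD2l lt_neqAle rN1.
rewrite [i%:R + r]addrC addrK /edge_pt /edge scalerBl scale1r scalerBr.
by rewrite addrAC -addrA.
Qed.

Lemma is_derive_affine (f : R -> 'rV[R]_3) a L :
  (\forall x \near a, f x = f a + (x - a) *: L) -> is_derive a 1 f L.
Proof.
move=> fL; apply: (@near_eq_is_derive _ _ _ (fun x => f a + (x - a) *: L)).
  by apply: filterS fL => x ->.
set g := fun x => _.
suff cg : h^-1 *: ((g \o shift a) (h *: 1) - g a) @[h --> 0^'] --> L.
  by split; [exact: cvgP cg | exact: (cvg_lim (@norm_hausdorff _ _) cg)].
suff /near_eq_cvg e : \forall h \near (0 : R)^',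
    (fun=> L) h = h^-1 *: ((g \o shift a) (h *: 1) - g a).
  exact: cvg_trans e (cvg_cst L).
near=> h.
have h0 : h != 0 by near: h; exact: nbhs_dnbhs_neq.
rewrite /g /= subrr scale0r addr0 addrK addrAC subrr add0r scalerA.
by rewrite [h *: 1]mulr1 mulVf// scale1r.
Unshelve. all: by end_near.
Qed.

Lemma is_derive_polygonal V i r : 0 < r < 1 ->
  is_derive (edge_time i r) 1 (polygonal V) (n.+1%:R *: edge V i).
Proof.
move=> r01; apply: is_derive_affine.
pose c t : R := n.+1%:R * t - i%:R.
have cr : c (edge_time i r) = r.
  by rewrite /c /edge_time mulrC divfK ?pnatr_eq0// addrC addKr.
have c01 : 0 < c (edge_time i r) < 1 by rewrite cr.
have cc : {for edge_time i r, continuous c}.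
  by apply: cvgB; [apply: cvgM; [exact: cvg_cst|exact: cvg_id]|exact: cvg_cst].
have /andP[c0 c1] := c01.
have := near_ltr (@cst_continuous _ _ (0 : R) _) cc c0.
have := near_ltr cc (@cst_continuous _ _ (1 : R) _) c1.
apply: filterS2 => t t1 t0.
have -> : t = edge_time i (c t).
  by rewrite /edge_time /c addrC subrK mulrAC divff ?pnatr_eq0// mul1r.
rewrite !polygonal_edge_time; last 2 first.
- by case/andP: r01 => /ltW-> /ltW->.
- by rewrite !ltW.
rewrite /edge_pt -addrA; congr (_ + _); rewrite scalerA -scalerDl.
congr (_ *: _); rewrite /edge_time -mulrBl divfK ?pnatr_eq0//.
by ring.
Qed.

End PolygonalCurve.

(** * Crossings of the projected edges *)

Section Cramer.
Variable R : realType.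
Implicit Types (u v a b xi : 'rV[R]_3) (r s : R).

Lemma det3C u v xi : det3 v u xi = - det3 u v xi.
Proof. by rewrite !det3E; ring. Qed.

Lemma det3uu u xi : det3 u u xi = 0.
Proof. by rewrite det3E; ring. Qed.

(** The difference of the two points is a multiple of [xi] exactly when its
    determinants against [u], [xi] and against [v], [xi] vanish; each of these
    determines one of the two parameters. *)
Lemma proj_lines_meet a b u v xi r s : dot xi xi = 1 -> det3 u v xi != 0 ->
  proj xi (a + r *: u) = proj xi (b + s *: v) <->
  r = det3 (b - a) v xi / det3 u v xi /\ s = det3 (a - b) u xi / det3 v u xi.
Proof.
move=> xi1 uv; have vu : det3 v u xi != 0 by rewrite det3C oppr_eq0.
split=> [/eqP|[r_eq s_eq]].
  rewrite -subr_eq0 -projB => /eqP /proj_eq0; set c := dot _ _ => e.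
  have -> : b - a = r *: u - s *: v - c *: xi.
    by rewrite -e; apply/rowP => j; rewrite !mxE; ring.
  have -> : a - b = s *: v - r *: u + c *: xi.
    by rewrite -e; apply/rowP => j; rewrite !mxE; ring.
  split; apply: (canRL (mulfK _)) => //; rewrite !det3E !mxE; ring.
apply/eqP; rewrite -subr_eq0 -projB; apply/eqP.
set w := a + _ - _.
have w1 : det3 w v xi = 0.
  have -> : det3 w v xi = r * det3 u v xi - det3 (b - a) v xi.
    by rewrite /w !det3E !mxE; ring.
  by rewrite r_eq divfK ?subrr.
have w2 : det3 u w xi = 0.
  have -> : det3 u w xi = s * det3 v u xi - det3 (a - b) u xi.
    by rewrite /w !det3E !mxE; ring.
  by rewrite s_eq divfK ?subrr.
have := cramer3 w u v xi; rewrite w1 w2 !scale0r !add0r => we.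
have -> : w = (det3 u v w / det3 u v xi) *: xi.
  by rewrite mulrC -scalerA -we scalerA mulVf ?scale1r.
exact: proj_colinear.
Qed.

End Cramer.

Section RegularDirection.
Variables (R : realType) (n : nat).
Implicit Types (V : 'M[R]_(n.+2, 3)) (xi : 'rV[R]_3) (i j k : 'I_n.+1).

(** The parameter on the line of edge [i] of its projected intersection with the
    line of edge [j].  If the projected lines are parallel, the quotient is the
    default value 0, which [edges_cross] rejects. *)
Definition edge_param V xi i j :=
  det3 (row (inord j) V - row (inord i) V) (edge V j) xi /
  det3 (edge V i) (edge V j) xi.

Definition edges_cross V xi i j :=
  (0 < edge_param V xi i j < 1) && (0 < edge_param V xi j i < 1).

(** The first clause starts from a meeting of closed edges and asks for
    transversality in the interiors and for different heights.  In the second,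
    [j = i] says that no edge is parallel to [xi], and [j = i.+1] that two
    consecutive edges do not fold over each other: they share a vertex, so
    that the first clause would always fail for them.  A fold is a combination
    of the two edges with nonnegative coefficients that is parallel to [xi],
    and normalizing the sum of the coefficients to 1 gives a compact set of
    parameters.  The third clause excludes triple points. *)
Definition regular V xi : Prop :=
  [/\ forall i j r s, (i.+1 < j)%N -> 0 <= r <= 1 -> 0 <= s <= 1 ->
        proj xi (edge_pt V i r) = proj xi (edge_pt V j s) ->
        edges_cross V xi i j /\ dot (edge_pt V i r - edge_pt V j s) xi != 0,
      forall i j p, (i <= j <= i.+1)%N -> 0 <= p <= 1 ->
        proj xi (p *: edge V i + (1 - p) *: edge V j) != 0
    & forall i j k, edges_cross V xi i j -> edges_cross V xi i k -> j != k ->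
        edge_param V xi i j != edge_param V xi i k].

Definition crossing_time V xi i j := edge_time n i (edge_param V xi i j).

Definition crossing_pt V xi i j := edge_pt V i (edge_param V xi i j).

Lemma edges_crossC V xi i j : edges_cross V xi i j = edges_cross V xi j i.
Proof. by rewrite /edges_cross andbC. Qed.

Lemma edges_cross_det V xi i j : edges_cross V xi i j ->
  det3 (edge V i) (edge V j) xi != 0.
Proof.
move=> /andP[/andP[r0 _] _]; apply: contraTneq r0 => d0.
by rewrite /edge_param d0 invr0 mulr0 ltxx.
Qed.

Lemma edges_cross_neq V xi i j : edges_cross V xi i j -> i != j.
Proof. by move=> /edges_cross_det; apply: contra_neq => ->; exact: det3uu. Qed.

Lemma edges_meetE V xi i j r s : dot xi xi = 1 ->
  det3 (edge V i) (edge V j) xi != 0 ->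
  proj xi (edge_pt V i r) = proj xi (edge_pt V j s) <->
  r = edge_param V xi i j /\ s = edge_param V xi j i.
Proof. exact: proj_lines_meet. Qed.

(** For [j = i.+1] the difference of the two points is minus
    [(1 - r) *: edge V i + s *: edge V j], whose coefficients are nonnegative
    and vanish together only at the common vertex. *)
Lemma adjacent_edges_meet V xi i j r s : (i <= j <= i.+1)%N ->
  (forall p, 0 <= p <= 1 -> proj xi (p *: edge V i + (1 - p) *: edge V j) != 0) ->
  0 <= r <= 1 -> 0 <= s <= 1 ->
  proj xi (edge_pt V i r) = proj xi (edge_pt V j s) ->
  edge_time n i r = edge_time n j s.
Proof.
move=> /andP[ij jij] near r01 s01 p; apply/eqP; apply: contraPT p => rs0.
move=> /eqP; rewrite -subr_eq0 -projB; move: rs0.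
(* A single edge is not parallel to [xi], so it is projected injectively. *)
have [ej|jNi] := eqVneq j i.
  rewrite ej => rs; rewrite (_ : _ - _ = (r - s) *: edge V i); last first.
    by rewrite /edge_pt opprD addrACA subrr add0r -scalerBl.
  rewrite projZ scaler_eq0 subr_eq0 => /orP[/eqP rs'|/eqP p0].
    by rewrite rs' eqxx in rs.
  have := near 1; rewrite ler01 lexx ej subrr scale1r scale0r addr0 p0 eqxx.
  by move=> /(_ isT).
have {jNi ij jij} ji : j = i.+1 :> nat.
  by apply/eqP; rewrite eqn_leq jij ltn_neqAle ij andbT eq_sym.
set m := (1 - r) + s => rs; have m0 : m != 0.
  apply: contra rs => /eqP m0; have [-> ->] : r = 1 /\ s = 0.
    by rewrite /m in m0; case/andP: r01 => ? ?; case/andP: s01 => ? ?; split; lra.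
  by rewrite /edge_time ji natr1 addr0.
have {m0} m_gt0 : 0 < m.
  rewrite lt_neqAle eq_sym m0 /m; case/andP: r01 => _ r1; case/andP: s01 => s0 _.
  by rewrite addr_ge0// subr_ge0.
rewrite (_ : _ - _ = (- m) *: (((1 - r) / m) *: edge V i +
                               (1 - (1 - r) / m) *: edge V j)); last first.
  have e1 : m * ((1 - r) / m) = 1 - r by rewrite mulrC divfK ?lt0r_neq0.
  have e2 : m * (1 - (1 - r) / m) = s by rewrite mulrBr e1 mulr1 addrAC subrr add0r.
  rewrite scalerDr !scalerA !mulNr e1 e2 /edge_pt ji /edge.
  by apply/rowP => l; rewrite !mxE; ring.
have p01 : 0 <= (1 - r) / m <= 1.
  case/andP: r01 => _ r1; case/andP: s01 => s0 _.
  by rewrite divr_ge0 ?subr_ge0 ?(ltW m_gt0)//= ler_pdivrMr// mul1r /m lerDl.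
rewrite projZ scaler_eq0 oppr_eq0 (negPf (lt0r_neq0 m_gt0)) /=.
by rewrite (negPf (near _ p01)).
Qed.

(** Every multiple point is a transversal crossing of two edges. *)
Lemma regularP V xi i j r s : dot xi xi = 1 -> regular V xi ->
  0 <= r <= 1 -> 0 <= s <= 1 -> edge_time n i r != edge_time n j s ->
  proj xi (edge_pt V i r) = proj xi (edge_pt V j s) ->
  [/\ edges_cross V xi i j, r = edge_param V xi i j & s = edge_param V xi j i].
Proof.
move=> xi1 [far near _]; wlog ij : i j r s / (i <= j)%N.
  move=> wl r01 s01 t p; case: (leqP i j) => [|/ltnW] ij; first exact: wl.
  rewrite edges_crossC; have [] := wl j i s r ij s01 r01; rewrite 1?eq_sym//.
move=> r01 s01; have [ij1|jij] := ltnP i.+1 j.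
  move=> _ p; have [c _] := far i j r s ij1 r01 s01 p.
  by have /(edges_meetE _ _ xi1 (edges_cross_det c))[? ?] := p; split.
have iij : (i <= j <= i.+1)%N by rewrite ij jij.
move=> /eqP rs p; case: rs.
exact: adjacent_edges_meet iij (fun q => near i j q iij) r01 s01 p.
Qed.

Lemma edges_cross_itv V xi i j : edges_cross V xi i j ->
  0 <= edge_param V xi i j <= 1.
Proof. by case/andP => /andP[/ltW -> /ltW ->]. Qed.

Lemma edges_cross_meet V xi i j : dot xi xi = 1 -> edges_cross V xi i j ->
  proj xi (crossing_pt V xi i j) = proj xi (crossing_pt V xi j i).
Proof. by move=> xi1 /edges_cross_det d; apply/(edges_meetE _ _ xi1 d). Qed.

Lemma polygonal_crossing_time V xi i j : edges_cross V xi i j ->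
  polygonal V (crossing_time V xi i j) = crossing_pt V xi i j.
Proof. by move=> /edges_cross_itv; exact: polygonal_edge_time. Qed.

Lemma derive1_crossing_time V xi i j : edges_cross V xi i j ->
  derivable (polygonal V) (crossing_time V xi i j) 1 /\
  derive1 (polygonal V) (crossing_time V xi i j) = n.+1%:R *: edge V i.
Proof.
case/andP => p01 _; have [dg <-] := is_derive_polygonal V i p01.
by split => //; rewrite derive1E.
Qed.

Lemma crossing_timeP V xi i j i' j' : edges_cross V xi i j ->
  edges_cross V xi i' j' -> crossing_time V xi i j = crossing_time V xi i' j' ->
  i = i' /\ edge_param V xi i j = edge_param V xi i' j'.
Proof. by case/andP => p01 _ /edges_cross_itv; exact: edge_time_inj. Qed.

Lemma adjacent_edges_not_cross V xi i j : dot xi xi = 1 ->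
  (i <= j <= i.+1)%N ->
  (forall p, 0 <= p <= 1 -> proj xi (p *: edge V i + (1 - p) *: edge V j) != 0) ->
  ~~ edges_cross V xi i j.
Proof.
move=> xi1 ij near; apply/negP => c.
have c' : edges_cross V xi j i by rewrite edges_crossC.
have ij0 := edges_cross_neq c.
have := adjacent_edges_meet ij near (edges_cross_itv c) (edges_cross_itv c')
  (edges_cross_meet xi1 c).
by move=> /(crossing_timeP c c')[ij' _]; rewrite ij' eqxx in ij0.
Qed.

(** A time belongs to at most one crossing: it determines the edge, and without
    triple points the parameter determines the other edge. *)
Lemma regular_crossing_inj V xi i j i' j' : regular V xi ->
  edges_cross V xi i j -> edges_cross V xi i' j' ->
  crossing_time V xi i j = crossing_time V xi i' j' -> (i, j) = (i', j').
Proof.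
move=> [_ _ triple] c c' /(crossing_timeP c c')[ii]; subst i'.
by move/eqP; apply: contraPeq => jj; apply/negP/triple => //; apply: contra_neq jj => ->.
Qed.

Lemma crossingP V xi s t : dot xi xi = 1 -> regular V xi ->
  crossing (polygonal V) xi s t <->
  exists i j, [/\ edges_cross V xi i j, s = crossing_time V xi i j
                & t = crossing_time V xi j i].
Proof.
move=> xi1 reg; split=> [[s01 t01]|[i [j [c -> ->]]]].
  have [i [r [r01 ->]]] := edge_timeP n s01.
  have [j [q [q01 ->]]] := edge_timeP n t01.
  rewrite !polygonal_edge_time// => rq /(regularP xi1 reg r01 q01 rq)[c -> ->].
  by exists i, j.
have c' : edges_cross V xi j i by rewrite edges_crossC.
split.
- exact/edge_time_itv/edges_cross_itv.
- exact/edge_time_itv/edges_cross_itv.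
- apply: contra_neq (edges_cross_neq c) => st.
  by have [] := crossing_timeP c c' st.
- by rewrite !polygonal_crossing_time//; exact: edges_cross_meet.
Qed.

Lemma regular_generic V xi : dot xi xi = 1 -> regular V xi ->
  generic (polygonal V) xi.
Proof.
move=> xi1 reg; split.
- pose h (e : 'I_n.+1 * 'I_n.+1) :=
    (crossing_time V xi e.1 e.2, crossing_time V xi e.2 e.1).
  apply: (sub_finite_set _ (finite_image h (@finite_finset _ setT))).
  move=> -[s t] /= /(crossingP _ _ xi1 reg)[i [j [_ -> ->]]].
  by exists (i, j).
- move=> s t /(crossingP _ _ xi1 reg)[i [j [c -> _]]].
  split; last by have [] := derive1_crossing_time c.
  by case/andP: c => + _; exact: edge_time_oo.
- move=> s t /(crossingP _ _ xi1 reg)[i [j [c -> ->]]].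
  have c' : edges_cross V xi j i by rewrite edges_crossC.
  have [_ ->] := derive1_crossing_time c.
  have [_ ->] := derive1_crossing_time c'.
  have -> : det3 (n.+1%:R *: edge V i) (n.+1%:R *: edge V j) xi =
      n.+1%:R ^+ 2 * det3 (edge V i) (edge V j) xi.
    by rewrite !det3E !mxE; ring.
  by rewrite mulf_neq0 ?expf_neq0 ?pnatr_eq0 ?edges_cross_det.
- move=> s t u /(crossingP _ _ xi1 reg)[i [j [c -> ->]]].
  move=> /(crossingP _ _ xi1 reg)[i' [j' [c' e ->]]].
  by have [-> ->] := regular_crossing_inj reg c c' e.
Qed.

End RegularDirection.

(** * The alternating sum over quadruples of edges *)

Section AlternatingSum.
Variables (R : realType) (n : nat).
Implicit Types (V : 'M[R]_(n.+2, 3)) (xi : 'rV[R]_3) (i j k : 'I_n.+1).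

Definition crossing_over V xi i j : bool :=
  dot (crossing_pt V xi j i) xi < dot (crossing_pt V xi i j) xi.

Definition edges_sign V xi i j : R :=
  if crossing_over V xi i j then Num.sg (det3 (edge V i) (edge V j) xi)
  else Num.sg (det3 (edge V j) (edge V i) xi).

Definition alternating_edges V xi (e : 'I_n.+1 * 'I_n.+1 * 'I_n.+1 * 'I_n.+1) :=
  let: (i1, i2, i3, i4) := e in
  [&& edges_cross V xi i1 i3, edges_cross V xi i2 i4,
      crossing_time V xi i4 i2 < crossing_time V xi i3 i1,
      crossing_time V xi i3 i1 < crossing_time V xi i2 i4,
      crossing_time V xi i2 i4 < crossing_time V xi i1 i3 &
      (crossing_over V xi i1 i3 && crossing_over V xi i4 i2) ||
      (crossing_over V xi i3 i1 && crossing_over V xi i2 i4)].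

Definition edge_alternating_sum V xi : R :=
  \sum_(e | alternating_edges V xi e)
    (let: (i1, i2, i3, i4) := e in
     edges_sign V xi i1 i3 * edges_sign V xi i2 i4).

Lemma over_crossing_time V xi i j : edges_cross V xi i j ->
  Defs.over (polygonal V) xi (crossing_time V xi i j) (crossing_time V xi j i) =
  crossing_over V xi i j.
Proof.
move=> c; have c' : edges_cross V xi j i by rewrite edges_crossC.
by rewrite /Defs.over !polygonal_crossing_time.
Qed.

(** The curve runs through each edge with speed factor [n.+1], which rescales
    the determinant by a positive number. *)
Lemma crossing_sign_time V xi i j : edges_cross V xi i j ->
  crossing_sign (polygonal V) xi (crossing_time V xi i j)
    (crossing_time V xi j i) = edges_sign V xi i j.
Proof.
move=> c; have c' : edges_cross V xi j i by rewrite edges_crossC.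
rewrite /crossing_sign over_crossing_time//.
have [_ ->] := derive1_crossing_time c; have [_ ->] := derive1_crossing_time c'.
have det_speed u v : Num.sg (det3 (n.+1%:R *: u) (n.+1%:R *: v) xi) =
    Num.sg (det3 u v xi).
  have -> : det3 (n.+1%:R *: u) (n.+1%:R *: v) xi =
      n.+1%:R ^+ 2 * det3 u v xi by rewrite !det3E !mxE; ring.
  by rewrite sgrM gtr0_sg ?mul1r// exprn_gt0// ltr0n.
by rewrite !det_speed.
Qed.

(** Taking times of passage turns the quadruples of edges into the alternating
    quadruples of times, injectively because there are no triple points. *)
Lemma alternating_sumE V xi : dot xi xi = 1 -> regular V xi ->
  alternating_sum (polygonal V) xi = edge_alternating_sum V xi.
Proof.
move=> xi1 reg.
pose h (e : 'I_n.+1 * 'I_n.+1 * 'I_n.+1 * 'I_n.+1) := let: (i1, i2, i3, i4) := e in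
  (crossing_time V xi i1 i3, crossing_time V xi i2 i4,
   crossing_time V xi i3 i1, crossing_time V xi i4 i2).
have hE : Defs.alternating (polygonal V) xi = h @` [set` alternating_edges V xi].
  apply/seteqP; split=> [[[[j1 j2] j3] j4]|_ [[[[i1 i2] i3] i4] /= +] <-] /=.
    move=> [[l43 l32 l21]] /(crossingP _ _ xi1 reg)[i1 [i3 [c13 e1 e3]]].
    move=> /(crossingP _ _ xi1 reg)[i2 [i4 [c24 e2 e4]]].
    have c31 : edges_cross V xi i3 i1 by rewrite edges_crossC.
    have c42 : edges_cross V xi i4 i2 by rewrite edges_crossC.
    subst j1 j2 j3 j4; rewrite !over_crossing_time// => o.
    exists (i1, i2, i3, i4) => //; apply/andP; split; first exact: c13.
    apply/and5P; split; do ?assumption.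
    by case: o => -[-> ->] //; rewrite orbT.
  move=> /andP[c13 /and5P[c24 l43 l32 l21 o]].
  have c31 : edges_cross V xi i3 i1 by rewrite edges_crossC.
  have c42 : edges_cross V xi i4 i2 by rewrite edges_crossC.
  split; first by split.
  - by apply/(crossingP _ _ xi1 reg); exists i1, i3.
  - by apply/(crossingP _ _ xi1 reg); exists i2, i4.
  - by rewrite !over_crossing_time//; case/orP: o => /andP; [left|right].
rewrite /alternating_sum hE fsbig_image.
  rewrite -(@bigfs _ _ _ _ (index_enum _) (alternating_edges V xi)).
  - apply: eq_bigr => -[[[i1 i2] i3] i4] /= /andP[c13 /andP[c24 _]].
    by rewrite !crossing_sign_time.
  - exact: index_enum_uniq.
  - by move=> e _; rewrite mem_index_enum.
move=> [[[i1 i2] i3] i4] [[[k1 k2] k3] k4] /set_mem /andP[c13 /andP[c24 _]].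
move=> /set_mem /andP[k13 /andP[k24 _]] [e13 e24 _ _].
have [-> ->] := regular_crossing_inj reg c13 k13 e13.
by have [-> ->] := regular_crossing_inj reg c24 k24 e24.
Qed.

Lemma norm_edge_alternating_sum V xi :
  `|edge_alternating_sum V xi| <=
  #|{: 'I_n.+1 * 'I_n.+1 * 'I_n.+1 * 'I_n.+1}|%:R.
Proof.
rewrite /edge_alternating_sum big_mkcond /= (le_trans (ler_norm_sum _ _ _))//.
rewrite -sum1_card natr_sum ler_sum// => -[[[i1 i2] i3] i4] _.
case: ifPn => _; last by rewrite normr0.
have sg1 (x : R) : `|Num.sg x| <= 1.
  by rewrite normr_sg lern1; case: (_ == _).
have s1 i j : `|edges_sign V xi i j| <= 1 by rewrite /edges_sign; case: ifP.
by rewrite normrM mulr_ile1.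
Qed.

End AlternatingSum.

(** * Continuity of the crossing data *)

Section PolygonContinuity.
Variables (R : realType) (n : nat) (W : topologicalType).
Variables (m : W -> 'M[R]_(n.+2, 3)) (a : W -> R * R) (w : W).
Hypotheses (cm : {for w, continuous m}) (ca : {for w, continuous a}).

Lemma dot_sphere_point (b : R * R) : dot (sphere_point b) (sphere_point b) = 1.
Proof.
rewrite dotE !mxE /= -[RHS](cos2Dsin2 b.2) -[sin b.2 ^+ 2]mulr1.
by rewrite -(cos2Dsin2 b.1); ring.
Qed.

Lemma coord_cont_sphere_point : coord_cont (fun y => sphere_point (a y)) w.
Proof.
have c1 : {for w, continuous (fun y => (a y).1)}.
  exact: (cvg_comp _ _ ca cvg_fst).
have c2 : {for w, continuous (fun y => (a y).2)}.
  exact: (cvg_comp _ _ ca cvg_snd).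
have cs1 : {for w, continuous (fun y => sin (a y).1)}.
  exact: (continuous_comp c1 (@continuous_sin _ _)).
have cc1 : {for w, continuous (fun y => cos (a y).1)}.
  exact: (continuous_comp c1 (@continuous_cos _ _)).
have cs2 : {for w, continuous (fun y => sin (a y).2)}.
  exact: (continuous_comp c2 (@continuous_sin _ _)).
have cc2 : {for w, continuous (fun y => cos (a y).2)}.
  exact: (continuous_comp c2 (@continuous_cos _ _)).
move=> -[[|[|[|//]]] lti].
- rewrite (_ : (fun y => _) = fun y => sin (a y).2 * cos (a y).1).
    exact: cvgM.
  by apply/funext => y; rewrite mxE.
- rewrite (_ : (fun y => _) = fun y => sin (a y).2 * sin (a y).1).
    exact: cvgM.
  by apply/funext => y; rewrite mxE.
- rewrite (_ : (fun y => _) = fun y => cos (a y).2) //.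
  by apply/funext => y; rewrite mxE.
Qed.

Lemma coord_cont_row k : coord_cont (fun y => row k (m y)) w.
Proof.
move=> j; rewrite (_ : (fun y => _) = fun y => m y k j).
  exact: (continuous_comp cm (@coord_continuous _ _ _ _ _ _)).
by apply/funext => y; rewrite mxE.
Qed.

Lemma coord_cont_edge k : coord_cont (fun y => edge (m y) k) w.
Proof. by apply: coord_contB; exact: coord_cont_row. Qed.

Lemma coord_cont_edge_pt (p : W -> R) k : {for w, continuous p} ->
  coord_cont (fun y => edge_pt (m y) k (p y)) w.
Proof.
move=> cp; apply: coord_contD; first exact: coord_cont_row.
by apply: coord_contZ => //; exact: coord_cont_edge.
Qed.

Implicit Types i j k : 'I_n.+1.

Lemma cont_edge_det i j : {for w, continuous
  (fun y => det3 (edge (m y) i) (edge (m y) j) (sphere_point (a y)))}.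
Proof.
by apply: cont_det3; by [exact: coord_cont_edge|exact: coord_cont_sphere_point].
Qed.

Lemma cont_edge_param i j : edges_cross (m w) (sphere_point (a w)) i j ->
  {for w, continuous (fun y => edge_param (m y) (sphere_point (a y)) i j)}.
Proof.
move=> /edges_cross_det d0.
have cnum : {for w, continuous (fun y => det3
    (row (inord j) (m y) - row (inord i) (m y)) (edge (m y) j)
    (sphere_point (a y)))}.
  apply: cont_det3; last exact: coord_cont_sphere_point.
    by apply: coord_contB; exact: coord_cont_row.
  exact: coord_cont_edge.
by apply: cvgM; [exact: cnum | apply: cvgV => //; exact: cont_edge_det].
Qed.

Lemma cont_crossing_time i j : edges_cross (m w) (sphere_point (a w)) i j ->
  {for w, continuous (fun y => crossing_time (m y) (sphere_point (a y)) i j)}.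
Proof.
move=> c; have cs : {for w, continuous (fun y =>
    i%:R + edge_param (m y) (sphere_point (a y)) i j)}.
  by apply: cvgD; [exact: cvg_cst|exact: cont_edge_param].
exact: cvgM cs (cvg_cst _).
Qed.

Lemma coord_cont_crossing_pt i j : edges_cross (m w) (sphere_point (a w)) i j ->
  coord_cont (fun y => crossing_pt (m y) (sphere_point (a y)) i j) w.
Proof. by move=> c; apply: coord_cont_edge_pt; exact: cont_edge_param. Qed.

Lemma near_edges_cross i j : edges_cross (m w) (sphere_point (a w)) i j ->
  \forall y \near w, edges_cross (m y) (sphere_point (a y)) i j.
Proof.
move=> c; have c' := c; rewrite edges_crossC in c'.
case/andP: (c) => /andP[p0 p1] /andP[q0 q1].
have cp := cont_edge_param c; have cq := cont_edge_param c'.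
near=> y; rewrite /edges_cross; apply/andP; split; apply/andP; split; near: y.
- exact: near_ltr (@cst_continuous _ _ (0 : R) _) cp p0.
- exact: near_ltr cp (@cst_continuous _ _ (1 : R) _) p1.
- exact: near_ltr (@cst_continuous _ _ (0 : R) _) cq q0.
- exact: near_ltr cq (@cst_continuous _ _ (1 : R) _) q1.
Unshelve. all: by end_near.
Qed.

End PolygonContinuity.

(** * Stability of regular directions *)

Lemma near_neq0 (R : realType) (Z : topologicalType) (p : Z -> R) (z : Z) :
  {for z, continuous p} -> p z != 0 -> \forall y \near z, p y != 0.
Proof. by move=> cp; exact: cvgr_neq0. Qed.

Lemma near_forall_fin (Z : topologicalType) (I : finType) (P : I -> Z -> Prop)
    (z : Z) : (forall i, \forall y \near z, P i y) ->
  \forall y \near z, forall i, P i y.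
Proof. exact: filter_forall. Qed.

Section RegularOpen.
Variables (R : realType) (n : nat).
Local Notation Z := ('M[R]_(n.+2, 3) * (R * R))%type.
Implicit Types (z : Z) (i j k : 'I_n.+1).

Let cfst z : {for z, continuous (@fst 'M[R]_(n.+2, 3) (R * R))}.
Proof. exact: cvg_fst. Qed.

Let csnd z : {for z, continuous (@snd 'M[R]_(n.+2, 3) (R * R))}.
Proof. exact: cvg_snd. Qed.

Let cfst2 (X : topologicalType) z (x : X) :
  {for (z, x), continuous (fun y : Z * X => y.1.1)}.
Proof.
have h : {for (z, x), continuous (@fst Z X)} by exact: cvg_fst.
exact: (continuous_comp h (@cfst z)).
Qed.

Let csnd2 (X : topologicalType) z (x : X) :
  {for (z, x), continuous (fun y : Z * X => y.1.2)}.
Proof.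
have h : {for (z, x), continuous (@fst Z X)} by exact: cvg_fst.
exact: (continuous_comp h (@csnd z)).
Qed.

Let near_adjacent z i j :
  (forall p, 0 <= p <= 1 -> proj (sphere_point z.2)
     (p *: edge z.1 i + (1 - p) *: edge z.1 j) != 0) ->
  \forall y \near z, forall p, 0 <= p <= 1 -> proj (sphere_point y.2)
     (p *: edge y.1 i + (1 - p) *: edge y.1 j) != 0.
Proof.
move=> zij.
pose f (y : Z * R) := proj (sphere_point y.1.2)
  (y.2 *: edge y.1.1 i + (1 - y.2) *: edge y.1.1 j).
have cf (x : R) : `[0, 1]%classic x -> coord_cont f (z, x).
  move=> _; apply: coord_cont_proj.
    by apply: coord_cont_sphere_point; exact: csnd2.
  apply: coord_contD; apply: coord_contZ; do ?by apply: coord_cont_edge; exact: cfst2.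
    exact: cvg_snd.
  by apply: cvgB; [exact: cvg_cst|exact: cvg_snd].
have f0 (x : R) : `[0, 1]%classic x -> f (z, x) != 0.
  by rewrite /= in_itv => /zij.
have := near_compact_neq0 (@segment_compact _ _ _) cf f0.
by apply: filterS => y yf p p01; apply: (yf p); rewrite /= in_itv.
Qed.

Let near_disjoint z i j :
  (forall r s, 0 <= r <= 1 -> 0 <= s <= 1 -> proj (sphere_point z.2)
     (edge_pt z.1 i r - edge_pt z.1 j s) != 0) ->
  \forall y \near z, forall r s, 0 <= r <= 1 -> 0 <= s <= 1 ->
    proj (sphere_point y.2) (edge_pt y.1 i r - edge_pt y.1 j s) != 0.
Proof.
move=> zij.
pose f (y : Z * (R * R)) := proj (sphere_point y.1.2)
  (edge_pt y.1.1 i y.2.1 - edge_pt y.1.1 j y.2.2).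
pose K : set (R * R) := `[0, 1] `*` `[0, 1].
have cf (x : R * R) : K x -> coord_cont f (z, x).
  have c2 : {for (z, x), continuous (@snd Z (R * R))} by exact: cvg_snd.
  move=> _; apply: coord_cont_proj.
    by apply: coord_cont_sphere_point; exact: csnd2.
  apply: coord_contB; apply: coord_cont_edge_pt; do ?exact: cfst2.
    exact: (continuous_comp c2 (@cvg_fst _ _ _ _ _)).
  exact: (continuous_comp c2 (@cvg_snd _ _ _ _ _)).
have f0 (x : R * R) : K x -> f (z, x) != 0.
  by case=> /=; rewrite !in_itv; exact: zij.
have cK : compact K by apply: compact_setX; exact: segment_compact.
have := near_compact_neq0 cK cf f0.
by apply: filterS => y yf r s r01 s01; apply: (yf (r, s)); split; rewrite /= in_itv.
Qed.

Let near_edges_cross_pair z i j : edges_cross z.1 (sphere_point z.2) i j ->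
  \forall y \near z, edges_cross y.1 (sphere_point y.2) i j.
Proof. exact: (@near_edges_cross R n _ fst snd z (@cfst z) (@csnd z) i j). Qed.

Let far_edges_disjoint z i j : regular z.1 (sphere_point z.2) ->
  (i.+1 < j)%N -> ~~ edges_cross z.1 (sphere_point z.2) i j ->
  forall r s, 0 <= r <= 1 -> 0 <= s <= 1 ->
    proj (sphere_point z.2) (edge_pt z.1 i r - edge_pt z.1 j s) != 0.
Proof.
move=> [far _ _] ij nc r s r01 s01; apply: contra nc.
by rewrite projB subr_eq0 => /eqP /(far i j r s ij r01 s01)[].
Qed.

(** Crossings persist by continuity of the parameters.  Non-crossings persist by
    compactness: in a regular direction two edges that do not cross do not
    even touch, apart from the common vertex of consecutive edges. *)
Lemma near_eq_edges_cross z i j : regular z.1 (sphere_point z.2) ->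
  \forall y \near z, edges_cross y.1 (sphere_point y.2) i j =
                     edges_cross z.1 (sphere_point z.2) i j.
Proof.
move=> reg; have [c|nc] := boolP (edges_cross z.1 (sphere_point z.2) i j).
  exact: near_edges_cross_pair c.
wlog ij : i j nc / (i <= j)%N.
  move=> wl; case: (leqP i j) => [|/ltnW] ij; first exact: wl.
  have := wl j i; rewrite edges_crossC => /(_ nc ij).
  by apply: filterS => y; rewrite edges_crossC.
have [ij1|jij] := ltnP i.+1 j.
  have := near_disjoint (far_edges_disjoint reg ij1 nc).
  apply: filterS => y dis; apply/negbTE/negP => c.
  have c' : edges_cross y.1 (sphere_point y.2) j i by rewrite edges_crossC.
  have := dis _ _ (edges_cross_itv c) (edges_cross_itv c').
  rewrite projB subr_eq0 => /eqP; apply.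
  exact: edges_cross_meet (dot_sphere_point _) c.
have iij : (i <= j <= i.+1)%N by rewrite ij jij.
case: reg => _ adj _; have := near_adjacent (fun p => adj i j p iij).
apply: filterS => y yadj; apply/negbTE.
exact: adjacent_edges_not_cross (dot_sphere_point _) iij yadj.
Qed.

Lemma near_regular z : regular z.1 (sphere_point z.2) ->
  \forall y \near z, regular y.1 (sphere_point y.2).
Proof.
move=> reg; have [far adj triple] := reg.
(* Near a crossing, every meeting of the two closed edges is that crossing. *)
have near_far : \forall y \near z, forall i j, (i.+1 < j)%N -> forall r s,
    0 <= r <= 1 -> 0 <= s <= 1 ->
    proj (sphere_point y.2) (edge_pt y.1 i r) =
    proj (sphere_point y.2) (edge_pt y.1 j s) ->
    edges_cross y.1 (sphere_point y.2) i j /\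
    dot (edge_pt y.1 i r - edge_pt y.1 j s) (sphere_point y.2) != 0.
  apply: near_forall_fin => i; apply: near_forall_fin => j.
  have [ij|/negbTE ij] := boolP (i.+1 < j)%N; last by near=> y.
  have [c|nc] := boolP (edges_cross z.1 (sphere_point z.2) i j); last first.
    have := near_disjoint (far_edges_disjoint reg ij nc).
    apply: filterS => y dis _ r s r01 s01 /eqP.
    by rewrite -subr_eq0 -projB => p; have := dis r s r01 s01; rewrite p.
  have c' : edges_cross z.1 (sphere_point z.2) j i by rewrite edges_crossC.
  have [_ d0] := far i j _ _ ij (edges_cross_itv c) (edges_cross_itv c')
    (edges_cross_meet (dot_sphere_point _) c).
  have cd : {for z, continuous (fun y : Z => dot
      (crossing_pt y.1 (sphere_point y.2) i j -
       crossing_pt y.1 (sphere_point y.2) j i) (sphere_point y.2))}.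
    apply: cont_dot; last exact: coord_cont_sphere_point.
    by apply: coord_contB; apply: coord_cont_crossing_pt.
  have nd := near_neq0 cd d0.
  have nc := near_edges_cross_pair c.
  move: nd nc; apply: filterS2 => y yd yc _ r s _ _.
  by move=> /(edges_meetE _ _ (dot_sphere_point _) (edges_cross_det yc))[-> ->].
have near_adj : \forall y \near z, forall i j, (i <= j <= i.+1)%N -> forall p,
    0 <= p <= 1 -> proj (sphere_point y.2)
     (p *: edge y.1 i + (1 - p) *: edge y.1 j) != 0.
  apply: near_forall_fin => i; apply: near_forall_fin => j.
  have [ij|/negbTE ij] := boolP (i <= j <= i.+1)%N; last by near=> y.
  have := near_adjacent (fun p => adj i j p ij).
  by apply: filterS => y yp _.
have near_triple : \forall y \near z, forall i j k,
    edges_cross y.1 (sphere_point y.2) i j ->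
    edges_cross y.1 (sphere_point y.2) i k -> j != k ->
    edge_param y.1 (sphere_point y.2) i j !=
    edge_param y.1 (sphere_point y.2) i k.
  apply: near_forall_fin => i; apply: near_forall_fin => j.
  apply: near_forall_fin => k.
  have nj := near_eq_edges_cross i j reg; have nk := near_eq_edges_cross i k reg.
  have [cj|/negbTE ncj] := boolP (edges_cross z.1 (sphere_point z.2) i j); last first.
    by move: nj; apply: filterS => y ->; rewrite ncj.
  have [ck|/negbTE nck] := boolP (edges_cross z.1 (sphere_point z.2) i k); last first.
    by move: nk; apply: filterS => y ->; rewrite nck.
  have [jk|jk] := eqVneq j k; first by near=> y.
  have cB : {for z, continuous (fun y : Z =>
      edge_param y.1 (sphere_point y.2) i j -
      edge_param y.1 (sphere_point y.2) i k)}.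
    by apply: cvgB; apply: cont_edge_param.
  have B0 := triple i j k cj ck jk; rewrite -subr_eq0 in B0.
  by have := near_neq0 cB B0; apply: filterS => y; rewrite subr_eq0.
move: near_far near_adj near_triple; apply: filterS3 => y yf ya yt.
split=> //; first by move=> i j r s ij; exact: yf.
by move=> i j p ij; exact: ya.
Unshelve. all: by end_near.
Qed.


(** The heights must differ for over and under to be stable. *)
Lemma regular_over_neq (V : 'M[R]_(n.+2, 3)) xi i j : dot xi xi = 1 ->
  regular V xi -> edges_cross V xi i j ->
  dot (crossing_pt V xi j i) xi != dot (crossing_pt V xi i j) xi.
Proof.
move=> xi1 [far adj _]; wlog ij : i j / (i <= j)%N.
  move=> wl c; case: (leqP i j) => [|/ltnW] ij; first exact: wl.
  by rewrite eq_sym wl// edges_crossC.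
have [ij1|jij] := ltnP i.+1 j; last first.
  have iij : (i <= j <= i.+1)%N by rewrite ij jij.
  have := adjacent_edges_not_cross xi1 iij (fun p => adj i j p iij).
  by move=> /negP.
move=> c; have c' : edges_cross V xi j i by rewrite edges_crossC.
have [_] := far i j _ _ ij1 (edges_cross_itv c) (edges_cross_itv c')
  (edges_cross_meet xi1 c).
apply: contra => /eqP; rewrite /crossing_pt => e; apply/eqP.
transitivity (dot (edge_pt V i (edge_param V xi i j)) xi -
              dot (edge_pt V j (edge_param V xi j i)) xi).
  by rewrite !dotE !mxE; ring.
by rewrite e subrr.
Qed.

Let near_over z i j : regular z.1 (sphere_point z.2) ->
  edges_cross z.1 (sphere_point z.2) i j ->
  \forall y \near z, crossing_over y.1 (sphere_point y.2) i j =
                     crossing_over z.1 (sphere_point z.2) i j.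
Proof.
move=> reg c; have c' : edges_cross z.1 (sphere_point z.2) j i.
  by rewrite edges_crossC.
apply: near_eq_ltr; last exact: regular_over_neq (dot_sphere_point _) reg c.
  apply: cont_dot; last exact: coord_cont_sphere_point.
  exact: coord_cont_crossing_pt.
apply: cont_dot; last exact: coord_cont_sphere_point.
exact: coord_cont_crossing_pt.
Qed.

Let near_sign z i j : regular z.1 (sphere_point z.2) ->
  edges_cross z.1 (sphere_point z.2) i j ->
  \forall y \near z, edges_sign y.1 (sphere_point y.2) i j =
                     edges_sign z.1 (sphere_point z.2) i j.
Proof.
move=> reg c; have c' : edges_cross z.1 (sphere_point z.2) j i.
  by rewrite edges_crossC.
have cd := @cont_edge_det R n _ fst snd z (@cfst z) (@csnd z).
have d := near_eq_sg (@cd i j) (edges_cross_det c).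
have d' := near_eq_sg (@cd j i) (edges_cross_det c').
move: (near_over reg c) d d'; apply: filterS3 => y yo yd yd'.
by rewrite /edges_sign yo yd yd'.
Qed.

(** Distinct passages take place at distinct times. *)
Let near_time z i j k l : regular z.1 (sphere_point z.2) ->
  edges_cross z.1 (sphere_point z.2) i j ->
  edges_cross z.1 (sphere_point z.2) k l ->
  \forall y \near z,
    (crossing_time y.1 (sphere_point y.2) i j <
     crossing_time y.1 (sphere_point y.2) k l) =
    (crossing_time z.1 (sphere_point z.2) i j <
     crossing_time z.1 (sphere_point z.2) k l).
Proof.
move=> reg cij ckl; have [[-> ->]|ijkl] := eqVneq (i, j) (k, l).
  by near=> y; rewrite !ltxx.
apply: near_eq_ltr; do ?exact: cont_crossing_time.
by apply: contra_neq ijkl; exact: regular_crossing_inj reg cij ckl.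
Unshelve. all: by end_near.
Qed.

Let near_alternating_edges z e : regular z.1 (sphere_point z.2) ->
  \forall y \near z, alternating_edges y.1 (sphere_point y.2) e =
                     alternating_edges z.1 (sphere_point z.2) e.
Proof.
case: e => -[[i1 i2] i3] i4 reg; rewrite /alternating_edges.
(* The remaining conditions are stable only if both crossings are present. *)
have n13 := near_eq_edges_cross i1 i3 reg.
have n24 := near_eq_edges_cross i2 i4 reg.
have [c13|nc] := boolP (edges_cross z.1 (sphere_point z.2) i1 i3); last first.
  by move: n13; apply: filterS => y ->; rewrite (negPf nc).
have [c24|nc] := boolP (edges_cross z.1 (sphere_point z.2) i2 i4); last first.
  by move: n24; apply: filterS => y ->; rewrite (negPf nc) andbF.
have c31 : edges_cross z.1 (sphere_point z.2) i3 i1 by rewrite edges_crossC.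
have c42 : edges_cross z.1 (sphere_point z.2) i4 i2 by rewrite edges_crossC.
have t1 := near_time reg c42 c31; have t2 := near_time reg c31 c24.
have t3 := near_time reg c24 c13.
have o13 := near_over reg c13; have o31 := near_over reg c31.
have o24 := near_over reg c24; have o42 := near_over reg c42.
near=> y.
have -> : edges_cross y.1 (sphere_point y.2) i1 i3 =
          edges_cross z.1 (sphere_point z.2) i1 i3 by near: y.
have -> : edges_cross y.1 (sphere_point y.2) i2 i4 =
          edges_cross z.1 (sphere_point z.2) i2 i4 by near: y.
congr [&& _, _, _, _, _ & _ && _ || _ && _] => //; near: y.
Unshelve. all: by end_near.
Qed.

Lemma near_eq_edge_alternating_sum z : regular z.1 (sphere_point z.2) ->
  \forall y \near z, edge_alternating_sum y.1 (sphere_point y.2) =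
                     edge_alternating_sum z.1 (sphere_point z.2).
Proof.
move=> reg.
have na : \forall y \near z, forall e, alternating_edges y.1 (sphere_point y.2) e =
                     alternating_edges z.1 (sphere_point z.2) e.
  by apply: near_forall_fin => e; exact: near_alternating_edges.
have ns : \forall y \near z, forall i j, edges_cross z.1 (sphere_point z.2) i j ->
    edges_sign y.1 (sphere_point y.2) i j = edges_sign z.1 (sphere_point z.2) i j.
  apply: near_forall_fin => i; apply: near_forall_fin => j.
  have [c|nc] := boolP (edges_cross z.1 (sphere_point z.2) i j); last by near=> y.
  by have := near_sign reg c; apply: filterS => y ->.
move: na ns; apply: filterS2 => y ya ys.
rewrite /edge_alternating_sum; apply: eq_big => // -[[[i1 i2] i3] i4].
by rewrite ya /= => /andP[c13 /andP[c24 _]]; rewrite !ys.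
Unshelve. all: by end_near.
Qed.

End RegularOpen.

(** * Null sets of directions *)

Section TrigForm.
Variable R : realType.
Implicit Types (x y A B C : R).

(** The binary quadratic form with coefficients [A], [B], [C] on the unit circle,
    in the order sine, cosine. *)
Definition trig_form A B C x :=
  A * sin x ^+ 2 + B * (sin x * cos x) + C * cos x ^+ 2.

Lemma sin_sub_neq0 x y : x != y -> `|x - y| < pi -> sin (x - y) != 0.
Proof.
move=> xy; rewrite ltr_norml => /andP[h1 h2].
have [yx|yx|yx] := ltgtP x y; last by rewrite yx eqxx in xy.
  rewrite -opprB sinN oppr_eq0; apply/lt0r_neq0/sin_gt0_pi.
  by rewrite subr_gt0 yx /= -opprB ltrNl.
by apply/lt0r_neq0/sin_gt0_pi; rewrite subr_gt0 yx.
Qed.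

(** A binary quadratic form vanishing on three distinct lines is zero: the three
    equations have the homogeneous Vandermonde determinant [D], and the
    multipliers below are its cofactors. *)
Lemma trig_form_eq0 A B C x1 x2 x3 :
  sin (x1 - x2) != 0 -> sin (x1 - x3) != 0 -> sin (x2 - x3) != 0 ->
  trig_form A B C x1 = 0 -> trig_form A B C x2 = 0 -> trig_form A B C x3 = 0 ->
  [/\ A = 0, B = 0 & C = 0].
Proof.
move=> s12 s13 s23 e1 e2 e3.
set D := sin (x1 - x2) * sin (x1 - x3) * sin (x2 - x3).
have D0 : D != 0 by rewrite !mulf_neq0.
have DE : D = (sin x1 * cos x2 - cos x1 * sin x2) *
  (sin x1 * cos x3 - cos x1 * sin x3) * (sin x2 * cos x3 - cos x2 * sin x3).
  by rewrite /D !sinB.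
have cancel_D X : D * X = 0 -> X = 0.
  by move/eqP; rewrite mulf_eq0 (negPf D0) => /eqP.
set F := trig_form A B C in e1 e2 e3.
split; apply: cancel_D.
- transitivity (cos x2 * cos x3 * (sin x2 * cos x3 - cos x2 * sin x3) * F x1
    - cos x1 * cos x3 * (sin x1 * cos x3 - cos x1 * sin x3) * F x2
    + cos x1 * cos x2 * (sin x1 * cos x2 - cos x1 * sin x2) * F x3).
    by rewrite DE /F /trig_form; ring.
  by rewrite e1 e2 e3; ring.
- transitivity (- (sin x2 ^+ 2 * cos x3 ^+ 2 - cos x2 ^+ 2 * sin x3 ^+ 2) * F x1
    + (sin x1 ^+ 2 * cos x3 ^+ 2 - cos x1 ^+ 2 * sin x3 ^+ 2) * F x2
    - (sin x1 ^+ 2 * cos x2 ^+ 2 - cos x1 ^+ 2 * sin x2 ^+ 2) * F x3).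
    by rewrite DE /F /trig_form; ring.
  by rewrite e1 e2 e3; ring.
- transitivity (sin x2 * sin x3 * (sin x2 * cos x3 - cos x2 * sin x3) * F x1
    - sin x1 * sin x3 * (sin x1 * cos x3 - cos x1 * sin x3) * F x2
    + sin x1 * sin x2 * (sin x1 * cos x2 - cos x1 * sin x2) * F x3).
    by rewrite DE /F /trig_form; ring.
  by rewrite e1 e2 e3; ring.
Qed.

(** Two angles in a half-open interval of length [pi] span distinct lines, so a
    nonzero form has at most two zeros there. *)
Lemma finite_trig_form_zeros_half A B C a :
  ~ [/\ A = 0, B = 0 & C = 0] ->
  finite_set [set x | a <= x < a + pi /\ trig_form A B C x = 0].
Proof.
move=> nz; set Z := [set x | _].
have [[x1 Z1]|nZ] := pselect (exists x, Z x); last first.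
  by apply: (sub_finite_set _ (@finite_set0 R)) => x Zx; case: nZ; exists x.
have [[x2 [Z2 x12]]|nZ] := pselect (exists x, Z x /\ x1 != x); last first.
  apply: (sub_finite_set _ (finite_set1 x1)) => x Zx /=.
  by apply: contrapT => x1x; apply: nZ; exists x; split => //; apply/eqP => e; apply: x1x.
apply: (sub_finite_set _ (finite_set2 x1 x2)) => x3 Z3.
apply: contrapT => nx; apply: nz.
have x13 : x1 != x3 by apply/eqP => e; apply: nx; left.
have x23 : x2 != x3 by apply/eqP => e; apply: nx; right.
case: Z1 Z2 Z3 => /andP[? ?] e1 [/andP[? ?] e2] [/andP[? ?] e3].
by apply: trig_form_eq0 e1 e2 e3; apply: sin_sub_neq0 => //;
  rewrite ltr_norml; apply/andP; split; lra.
Qed.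

Lemma finite_trig_form_zeros A B C : ~ [/\ A = 0, B = 0 & C = 0] ->
  finite_set [set x | 0 <= x <= 2 * pi /\ trig_form A B C x = 0].
Proof.
move=> nz.
have := finite_trig_form_zeros_half (2 * pi) nz.
have := finite_trig_form_zeros_half pi nz.
have := finite_trig_form_zeros_half 0 nz.
rewrite add0r => f0 f1 f2.
have : finite_set ([set x | 0 <= x < pi /\ trig_form A B C x = 0] `|`
  ([set x | pi <= x < pi + pi /\ trig_form A B C x = 0] `|`
   [set x | 2 * pi <= x < 2 * pi + pi /\ trig_form A B C x = 0])).
  by rewrite !finite_setU.
have pi0 := pi_gt0 R.
apply: sub_finite_set => x [/andP[x0 x2] e].
have [h|h] := ltP x pi; first by left; rewrite /= x0 h.
right; have [h2|h2] := ltP x (pi + pi); first by left; rewrite /= h h2.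
by right; split=> //; apply/andP; split; lra.
Qed.

End TrigForm.

Section OpenMeasurable.
Variable R : realType.

(** Rectangles with rational corners form a countable base, so the product of
    the Borel sigma-algebras contains the open sets of the plane. *)
Lemma open_measurable_prod (A : set (R * R)) : open A -> measurable A.
Proof.
move=> oA.
pose I : set (rat * rat * rat * rat) := [set q |
  `]ratr q.1.1.1, ratr q.1.1.2[ `*` `]ratr q.1.2, ratr q.2[ `<=` A].
pose F (q : rat * rat * rat * rat) : set (R * R) :=
  if `[< I q >] then `]ratr q.1.1.1, ratr q.1.1.2[ `*` `]ratr q.1.2, ratr q.2[
  else set0.
have -> : A = \bigcup_q F q.
  apply/seteqP; split=> [[x y] Axy|xy [q _]]; last first.
    by rewrite /F; case: asboolP => // Iq; exact: Iq.
  have [[U V] /= [Ux Vy] UV] : nbhs (x, y) A by exact: open_nbhs_nbhs.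
  have rat_itv (z : R) (W : set R) : nbhs z W -> exists q1 q2 : rat,
      `]ratr q1, ratr q2[%classic z /\ `]ratr q1, ratr q2[ `<=` W.
    move=> /nbhs_ballP[e /= e0 eW].
    have [q1] := @rat_in_itvoo R (z - e) z ltac:(by rewrite ltrBlDr ltrDl).
    have [q2] := @rat_in_itvoo R z (z + e) ltac:(by rewrite ltrDl).
    rewrite !in_itv /= => /andP[h1 h2] /andP[h3 h4].
    exists q1, q2; split; first by rewrite /= in_itv /= h1 h4.
    move=> t; rewrite /= in_itv /= => /andP[t1 t2]; apply: eW.
    by rewrite /ball /= ltr_distlC; apply/andP; split; lra.
  have [q1 [q2 [xq qU]]] := rat_itv _ _ Ux.
  have [q3 [q4 [yq qV]]] := rat_itv _ _ Vy.
  exists (q1, q2, q3, q4) => //; rewrite /F; case: asboolP => [_|[]]; first by split.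
  by move=> [s t] /= [/qU Us /qV Vt]; exact: UV.
apply: countable_bigcupT_measurable => // q; rewrite /F; case: asboolP => // _.
by apply: measurableX; exact: measurable_itv.
Qed.

End OpenMeasurable.

Definition angles (R : realType) : set (R * R) := `[0, 2 * pi] `*` `[0, pi].

Section QuadraticForms.
Variable R : realType.
Implicit Types (p q r s v : 'rV[R]_3) (N : set (R * R)).

Lemma product_measure0 N : measurable N ->
  (\forall x \ae lebesgue_measure, lebesgue_measure (xsection N x) = 0%E) ->
  angle_measure N = 0%E.
Proof.
move=> mN N0; rewrite /product_measure1.
rewrite (ae_eq_integral (cst 0%E))//; first by rewrite integral0.
  exact: measurable_fun_xsection.
case: N0 => M [mM M0 NM]; exists M; split=> // x /= nx; apply: NM => /= N0.
by apply: nx => _.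
Qed.

Lemma measurable_angles : measurable (@angles R).
Proof. by apply: measurableX; exact: measurable_itv. Qed.

Lemma measurable_angles_zeros (f : R * R -> R) : continuous f ->
  measurable (@angles R `&` [set a | f a = 0]).
Proof.
move=> cf; rewrite (_ : _ `&` _ = @angles R `\` (f @^-1` [set x | x != 0])).
  apply: measurableD; first exact: measurable_angles.
  apply: open_measurable_prod; move/continuousP: cf; apply.
  exact: open_neq.
apply/seteqP; split=> a [Da /= fa]; split => //=; first by rewrite fa eqxx.
by move: fa => /negP; rewrite negbK => /eqP.
Qed.

(** Differences of products of linear forms are all the quadratic forms that are
    needed.  For a fixed longitude [x] the form is a binary form in the sine and
    cosine of the colatitude, with coefficients [A x], [B x], [C].  It has
    finitely many zeros unless the coefficients vanish together, and this
    happens for finitely many [x] only because [A] and the square of [B] are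
    themselves binary forms in [x]. *)
Lemma ae_quadratic p q r s v :
  dot p v * dot q v - dot r v * dot s v != 0 ->
  \forall a \ae angle_measure, @angles R a ->
    dot p (sphere_point a) * dot q (sphere_point a)
    - dot r (sphere_point a) * dot s (sphere_point a) != 0.
Proof.
move=> v0; pose Q v := dot p v * dot q v - dot r v * dot s v.
have cQ : continuous (fun a => Q (sphere_point a)).
  move=> a; have cs := @coord_cont_sphere_point R _ id a (@cvg_id _ _).
  have cd u : {for a, continuous (fun b => dot u (sphere_point b))}.
    by apply: cont_dot cs => j; exact: cvg_cst.
  by apply: cvgB; apply: cvgM; exact: cd.
pose N := @angles R `&` [set a | Q (sphere_point a) = 0].
have mN : measurable N by exact: measurable_angles_zeros.
suff N0 : angle_measure N = 0%E.
  exists N; split=> // a; rewrite /= => /not_implyP[Da] /negP.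
  by rewrite negbK => /eqP.
apply: product_measure0 => //.
pose A x := trig_form
  (p 0 1 * q 0 1 - r 0 1 * s 0 1)
  (p 0 0 * q 0 1 + p 0 1 * q 0 0 - r 0 0 * s 0 1 - r 0 1 * s 0 0)
  (p 0 0 * q 0 0 - r 0 0 * s 0 0) x.
pose b0 := p 0 0 * q 0 2%:R + p 0 2%:R * q 0 0 - r 0 0 * s 0 2%:R - r 0 2%:R * s 0 0.
pose b1 := p 0 1 * q 0 2%:R + p 0 2%:R * q 0 1 - r 0 1 * s 0 2%:R - r 0 2%:R * s 0 1.
pose B x := b0 * cos x + b1 * sin x.
pose C := p 0 2%:R * q 0 2%:R - r 0 2%:R * s 0 2%:R.
have QE x y : Q (sphere_point (x, y)) = trig_form (A x) (B x) C y.
  by rewrite /Q !dotE !mxE /= /A /B /b0 /b1 /C /trig_form; ring.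
have fin : finite_set [set x | 0 <= x <= 2 * pi /\ [/\ A x = 0, B x = 0 & C = 0]].
  have [C0|C0] := eqVneq C 0; last first.
    apply: (sub_finite_set _ (@finite_set0 R)) => x [_ [_ _ /eqP]].
    by rewrite (negPf C0).
  have [|/finite_trig_form_zeros] := pselect
    [/\ p 0 1 * q 0 1 - r 0 1 * s 0 1 = 0,
        p 0 0 * q 0 1 + p 0 1 * q 0 0 - r 0 0 * s 0 1 - r 0 1 * s 0 0 = 0
      & p 0 0 * q 0 0 - r 0 0 * s 0 0 = 0]; last first.
    by apply: sub_finite_set => x [? []].
  move=> [a1 a2 a3].
  have [|/finite_trig_form_zeros] := pselect
    [/\ b1 ^+ 2 = 0, 2 * b0 * b1 = 0 & b0 ^+ 2 = 0]; last first.
    apply: sub_finite_set => x [x2 [_ Bx _]]; split => //.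
    have -> : trig_form (b1 ^+ 2) (2 * b0 * b1) (b0 ^+ 2) x = B x ^+ 2.
      by rewrite /trig_form /B; ring.
    by rewrite Bx expr0n.
  move=> [/eqP + _ /eqP]; rewrite !expf_eq0 /= => /eqP b10 /eqP b00.
  (* All the coefficients of the form vanish, hence its value at [v]. *)
  case/eqP: v0; transitivity
    ((p 0 1 * q 0 1 - r 0 1 * s 0 1) * v 0 1 ^+ 2 +
     (p 0 0 * q 0 1 + p 0 1 * q 0 0 - r 0 0 * s 0 1 - r 0 1 * s 0 0) *
       (v 0 0 * v 0 1) + (p 0 0 * q 0 0 - r 0 0 * s 0 0) * v 0 0 ^+ 2 +
     b0 * (v 0 0 * v 0 2%:R) + b1 * (v 0 1 * v 0 2%:R) + C * v 0 2%:R ^+ 2).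
    by rewrite !dotE /b0 /b1 /C; ring.
  by rewrite a1 a2 a3 b10 b00 C0; ring.
exists [set x | 0 <= x <= 2 * pi /\ [/\ A x = 0, B x = 0 & C = 0]]; split.
- exact: countable_measurable (finite_set_countable fin).
- exact: countable_lebesgue_measure0 (finite_set_countable fin).
move=> x /=; apply: contra_notP => nx.
apply: countable_lebesgue_measure0; apply: finite_set_countable.
have [x2|nx2] := boolP (0 <= x <= 2 * pi); last first.
  apply: (sub_finite_set _ (@finite_set0 R)) => y.
  rewrite /xsection /= => /set_mem[[/= + _] _].
  by rewrite in_itv /= (negPf nx2).
have nz : ~ [/\ A x = 0, B x = 0 & C = 0] by move=> z; apply: nx.
have := finite_trig_form_zeros nz; apply: sub_finite_set => y.
rewrite /xsection /= => /set_mem[[/= _]]; rewrite in_itv /= QE => /andP[y0 y1] e.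
by split=> //; rewrite y0 /= (le_trans y1)// mulr_natl mulr2n lerDl pi_ge0.
Qed.

End QuadraticForms.

(** * Almost every direction avoids a given line *)

#[local] Instance filter_ae_angles (R : realType) : Filter
  (nbhs (almost_everywhere (@lebesgue_measure R \x @lebesgue_measure R)%E)).
Proof. exact _. Qed.

Section AlmostEveryDirection.
Variable R : realType.
Implicit Types (u v w xi : 'rV[R]_3) (P Q : R * R -> Prop).

Definition cross_prod u v : 'rV[R]_3 :=
  \row_(i < 3) [tuple u 0 1 * v 0 2%:R - u 0 2%:R * v 0 1;
    u 0 2%:R * v 0 0 - u 0 0 * v 0 2%:R; u 0 0 * v 0 1 - u 0 1 * v 0 0]`_i.

Lemma dot_cross_prod u v w : dot (cross_prod u v) w = det3 u v w.
Proof. by rewrite dotE det3E !mxE /=; ring. Qed.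

Lemma ae_angles_sub P Q : (forall a, P a -> Q a) ->
  (\forall a \ae angle_measure, @angles R a -> P a) ->
  \forall a \ae angle_measure, @angles R a -> Q a.
Proof. by move=> PQ; apply: filterS => a /[apply] /PQ. Qed.

Lemma ae_angles_and P Q :
  (\forall a \ae angle_measure, @angles R a -> P a) ->
  (\forall a \ae angle_measure, @angles R a -> Q a) ->
  \forall a \ae angle_measure, @angles R a -> P a /\ Q a.
Proof. by apply: filterS2 => a Pa Qa Da; split; [exact: Pa|exact: Qa]. Qed.

Lemma ae_angles_forall (I : finType) (F : I -> R * R -> Prop) :
  (forall i, \forall a \ae angle_measure, @angles R a -> F i a) ->
  \forall a \ae angle_measure, @angles R a -> forall i, F i a.
Proof. by move=> /filter_forall; apply: filterS => a Fa Da i; exact: Fa. Qed.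

Lemma ae_angles_all P : (forall a, P a) ->
  \forall a \ae angle_measure, @angles R a -> P a.
Proof. by move=> Pa; near=> a => _; exact: Pa. Unshelve. all: by end_near. Qed.

(** A linear form is nonzero where its square is. *)
Lemma ae_det3_neq0 u v xi : det3 u v xi != 0 ->
  \forall a \ae angle_measure, @angles R a -> det3 u v (sphere_point a) != 0.
Proof.
move=> d0; have := @ae_quadratic R (cross_prod u v) (cross_prod u v) 0 0 xi.
rewrite !dot_cross_prod (_ : dot 0 xi = 0); last by rewrite dotE !mxE; ring.
rewrite mulr0 subr0 mulf_neq0// => /(_ isT); apply: ae_angles_sub => a.
rewrite !dot_cross_prod (_ : dot 0 _ = 0); last by rewrite dotE !mxE; ring.
by rewrite mulr0 subr0 mulf_eq0 negb_or => /andP[].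
Qed.

Lemma det3_parallel u v : u != 0 -> (forall xi, det3 u v xi = 0) ->
  exists c, v = c *: u.
Proof.
move=> u0 uv; have [j uj] : exists j, u 0 j != 0.
  apply: contrapT => nj; case/eqP: u0; apply/rowP => j; rewrite mxE.
  by apply: contrapT => /eqP uj; apply: nj; exists j.
have e0 := uv (delta_mx 0 0); have e1 := uv (delta_mx 0 1).
have e2 := uv (delta_mx 0 2%:R).
rewrite !det3E !mxE /= in e0 e1 e2.
have c k : u 0 j * v 0 k = u 0 k * v 0 j.
  have ord3 (i : 'I_3) : [\/ i = 0, i = 1 | i = 2%:R].
    by case: i => -[|[|[|//]]] lti; [apply: Or31|apply: Or32|apply: Or33];
      apply/val_inj.
  by case: (ord3 j) => ->; case: (ord3 k) => ->; lra.
exists (v 0 j / u 0 j); apply/rowP => k; rewrite mxE.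
by apply: (mulfI uj); rewrite c mulrA [u 0 j * _]mulrC divfK// mulrC.
Qed.

Lemma ae_proj_neq0 u : u != 0 ->
  \forall a \ae angle_measure, @angles R a -> proj (sphere_point a) u != 0.
Proof.
move=> u0; have [[[v xi] /= d0]|nd] := pselect
    (exists vx : 'rV[R]_3 * 'rV[R]_3, det3 u vx.1 vx.2 != 0).
  apply: ae_angles_sub (ae_det3_neq0 d0) => a; apply: contra_neq => /proj_eq0 ->.
  by rewrite det3E !mxE; ring.
have par v : exists c, v = c *: u.
  apply: det3_parallel => // xi; apply: contrapT => /eqP d.
  by apply: nd; exists (v, xi).
have [c0 e0] := par (delta_mx 0 0); have [c1 e1] := par (delta_mx 0 1).
have := congr1 (fun x : 'rV[R]_3 => x 0 0) e0.
have := congr1 (fun x : 'rV[R]_3 => x 0 1) e0.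
have := congr1 (fun x : 'rV[R]_3 => x 0 0) e1.
have := congr1 (fun x : 'rV[R]_3 => x 0 1) e1.
rewrite !mxE /= => h1 h2 h3 h4; exfalso.
have : c0 * u 0 0 * (c1 * u 0 1) = c0 * u 0 1 * (c1 * u 0 0) by ring.
rewrite -h1 -h2 -h3 -h4 => /eqP.
by rewrite mulr1 mulr0 oner_eq0.
Qed.

(** The directions of the vectors on an affine line lie on a great circle, and
    are just two antipodal points if the line passes through the origin.  In
    that case its zero vector remains, which projects to 0 in all directions.
    All degenerate positions of two edges reduce to this. *)
Lemma ae_line w u : \forall a \ae angle_measure, @angles R a ->
  forall t, proj (sphere_point a) (w + t *: u) = 0 -> w + t *: u = 0.
Proof.
have [->|u0] := eqVneq u 0.
  have [->|w0] := eqVneq w 0.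
    by apply: ae_angles_all => a t _; rewrite scaler0 addr0.
  apply: ae_angles_sub (ae_proj_neq0 w0) => a + t.
  by rewrite scaler0 addr0 => /eqP.
have [[xi d0]|nd] := pselect (exists xi, det3 u w xi != 0).
  apply: ae_angles_sub (ae_det3_neq0 d0) => a da t /proj_eq0.
  set c := dot _ _ => e; case/eqP: da.
  have -> : w = c *: sphere_point a - t *: u by rewrite -e addrK.
  by rewrite !det3E !mxE; ring.
have [c ->] : exists c, w = c *: u.
  apply: det3_parallel => // xi; apply: contrapT => /eqP d.
  by apply: nd; exists xi.
apply: ae_angles_sub (ae_proj_neq0 u0) => a pu t.
rewrite -scalerDl projZ => /eqP; rewrite scaler_eq0 (negPf pu) orbF => /eqP ->.
by rewrite scale0r.
Qed.

End AlmostEveryDirection.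

(** * Almost every direction is regular for a simple polygon *)

Section SimplePolygon.
Variables (R : realType) (n : nat) (V : 'M[R]_(n.+2, 3)).
Hypothesis simpleV : simple_open_curve (polygonal V).
Implicit Types (i j k : 'I_n.+1) (r s : R).

Lemma simple_edge_pt i j r s : 0 <= r <= 1 -> 0 <= s <= 1 ->
  edge_pt V i r = edge_pt V j s -> edge_time n i r = edge_time n j s.
Proof.
move=> r01 s01; rewrite -!polygonal_edge_time// => e.
by apply: simpleV e; apply/mem_set; rewrite /= in_itv; exact: edge_time_itv.
Qed.

Lemma far_edge_pt_neq i j r s : (i.+1 < j)%N -> 0 <= r <= 1 -> 0 <= s <= 1 ->
  edge_pt V i r - edge_pt V j s != 0.
Proof.
move=> ij r01 s01; apply/negP; rewrite subr_eq0 => /eqP /(simple_edge_pt r01 s01).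
move/edge_time_eq => e.
have : (i.+2%:R : R) <= j%:R by rewrite ler_nat.
rewrite -addn2 natrD; case/andP: r01 => _ r1; case/andP: s01 => s0 _; lra.
Qed.

(** If consecutive edges had opposite directions, going back by [p] times the
    first from the common vertex would lead to the same point as going forward
    by [1 - p] times the second.  The combination is written as a point of the
    affine line through the two edge vectors, the form that [ae_line] takes. *)
Lemma adjacent_edges_independent i j p : (i <= j <= i.+1)%N -> 0 <= p <= 1 ->
  edge V j + p *: (edge V i - edge V j) != 0.
Proof.
move=> /andP[ij jij] /andP[p0 p1]; apply/eqP => e.
have [ji|ij'] := eqVneq j i.
  rewrite ji subrr scaler0 addr0 in e.
  have : edge_pt V i 0 = edge_pt V i 1 by rewrite /edge_pt e !scaler0.
  move/simple_edge_pt; rewrite !ler01 !lexx => /(_ isT isT) /edge_time_eq.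
  by move/addrI/eqP; rewrite eq_sym oner_eq0.
have {ij' ij jij} ji : j = i.+1 :> nat.
  by apply/eqP; rewrite eqn_leq jij ltn_neqAle ij andbT eq_sym.
have : edge_pt V i (1 - p) = edge_pt V j (1 - p).
  apply/eqP; rewrite -subr_eq0; apply/eqP; rewrite -[RHS]oppr0 -[X in _ = - X]e.
  by rewrite /edge_pt ji /edge; apply/rowP => l; rewrite !mxE; ring.
have p01 : 0 <= 1 - p <= 1 by apply/andP; split; lra.
move/(simple_edge_pt p01 p01)/edge_time_eq/addIr/eqP.
by rewrite eqr_nat ji eqn_leq ltnn andbF.
Qed.

(** Differences of points on the two edges run over an affine line when one of
    the points is a vertex, and also when the edges are parallel.  By [ae_line]
    such differences almost never project to 0, since simplicity prevents them
    from being 0. *)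
Lemma ae_far_edges i j : (i.+1 < j)%N ->
  \forall a \ae angle_measure, @angles R a ->
    forall r s, 0 <= r <= 1 -> 0 <= s <= 1 ->
      proj (sphere_point a) (edge_pt V i r) =
      proj (sphere_point a) (edge_pt V j s) ->
      edges_cross V (sphere_point a) i j /\
      dot (edge_pt V i r - edge_pt V j s) (sphere_point a) != 0.
Proof.
move=> ij; pose w := row (inord i) V - row (inord j) V.
have transversal : \forall a \ae angle_measure, @angles R a ->
    forall r s, 0 <= r <= 1 -> 0 <= s <= 1 ->
      proj (sphere_point a) (edge_pt V i r - edge_pt V j s) = 0 ->
      det3 (edge V i) (edge V j) (sphere_point a) != 0.
  have [[xi d0]|nd] := pselect (exists xi, det3 (edge V i) (edge V j) xi != 0).
    by apply: ae_angles_sub (ae_det3_neq0 d0) => a.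
  have i0 : edge V i != 0.
    have := @adjacent_edges_independent i i 0.
    by rewrite scale0r addr0 leqnn leqnSn lexx ler01 => /(_ isT isT).
  have [c jc] : exists c, edge V j = c *: edge V i.
    apply: det3_parallel => // xi; apply: contrapT => /eqP d.
    by apply: nd; exists xi.
  apply: ae_angles_sub (ae_line w (edge V i)) => a aw r s r01 s01.
  have e : edge_pt V i r - edge_pt V j s = w + (r - s * c) *: edge V i.
    by rewrite /edge_pt jc; apply/rowP => l; rewrite !mxE; ring.
  rewrite e => /aw w0; have := far_edge_pt_neq ij r01 s01.
  by rewrite e w0 eqxx.
(* Ends of edge [i] against edge [j], and ends of edge [j] against edge [i]. *)
have iE r s : edge_pt V i r - edge_pt V j s =
    edge_pt V i r - row (inord j) V + (- s) *: edge V j.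
  by apply/rowP => l; rewrite !mxE; ring.
have jE r s : edge_pt V i r - edge_pt V j s =
    row (inord i) V - edge_pt V j s + r *: edge V i.
  by apply/rowP => l; rewrite !mxE; ring.
have h0 := ae_line (edge_pt V i 0 - row (inord j) V) (edge V j).
have h1 := ae_line (edge_pt V i 1 - row (inord j) V) (edge V j).
have k0 := ae_line (row (inord i) V - edge_pt V j 0) (edge V i).
have k1 := ae_line (row (inord i) V - edge_pt V j 1) (edge V i).
have := ae_angles_and transversal (ae_angles_and (ae_angles_and h0 h1)
  (ae_angles_and k0 k1)).
apply: ae_angles_sub => a [tr [[ah0 ah1] [ak0 ak1]]] r s r01 s01 p.
have p0 : proj (sphere_point a) (edge_pt V i r - edge_pt V j s) = 0.
  by rewrite projB p subrr.
have ne := far_edge_pt_neq ij r01 s01.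
have r0 : r != 0.
  by apply: contra_neqN ne => /eqP r0; rewrite r0 iE in p0 *; exact: ah0 p0.
have r1 : r != 1.
  by apply: contra_neqN ne => /eqP r1; rewrite r1 iE in p0 *; exact: ah1 p0.
have s0 : s != 0.
  by apply: contra_neqN ne => /eqP s0; rewrite s0 jE in p0 *; exact: ak0 p0.
have s1 : s != 1.
  by apply: contra_neqN ne => /eqP s1; rewrite s1 jE in p0 *; exact: ak1 p0.
have d0 := tr r s r01 s01 p0.
split; last first.
  by apply: contra ne => /eqP d; rewrite (proj_eq0 p0) d scale0r.
have [re se] := (edges_meetE r s (dot_sphere_point a) d0).1 p.
case/andP: r01 => r0' r1'; case/andP: s01 => s0' s1'.
by rewrite /edges_cross -re -se !lt_neqAle r0' r1' s0' s1' r1 s1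
  [0 == r]eq_sym r0 [0 == s]eq_sym s0.
Qed.

Lemma ae_adjacent_edges i j : (i <= j <= i.+1)%N ->
  \forall a \ae angle_measure, @angles R a -> forall p, 0 <= p <= 1 ->
    proj (sphere_point a) (p *: edge V i + (1 - p) *: edge V j) != 0.
Proof.
move=> ij; apply: ae_angles_sub (ae_line (edge V j) (edge V i - edge V j)).
move=> a aw p p01; have -> : p *: edge V i + (1 - p) *: edge V j =
    edge V j + p *: (edge V i - edge V j).
  by apply/rowP => l; rewrite !mxE; ring.
by apply: contra_neq (adjacent_edges_independent ij p01); exact: aw.
Qed.

(** Equality of the two parameters on edge [i] is the vanishing of the quadratic
    form [l1 * l2 - l3 * l4].  Suppose that a triple point is seen along [xi],
    with the points of edges [j] and [k] displaced from that of edge [i] by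
    [al *: xi] and [be *: xi].  Then the value of the form at [xi + edge V i] is
    [(be - al) * l2 xi * l4 xi], and it is nonzero: the crossings are
    transversal, and [al = be] would be an intersection of edges [j] and [k].
    So the form is not identically zero, or there is no triple point at all. *)
Lemma ae_no_triple_point i j k : j != k ->
  \forall a \ae angle_measure, @angles R a ->
    edges_cross V (sphere_point a) i j -> edges_cross V (sphere_point a) i k ->
    edge_param V (sphere_point a) i j != edge_param V (sphere_point a) i k.
Proof.
move=> jk; pose l1 := det3 (row (inord j) V - row (inord i) V) (edge V j).
pose l2 := det3 (edge V i) (edge V k).
pose l3 := det3 (row (inord k) V - row (inord i) V) (edge V k).
pose l4 := det3 (edge V i) (edge V j).
have [[xi Q0]|Q0] := pselect (exists xi, l1 xi * l2 xi - l3 xi * l4 xi != 0).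
  rewrite /l1 /l2 /l3 /l4 -!dot_cross_prod in Q0.
  apply: ae_angles_sub (ae_quadratic Q0) => a + cj ck.
  rewrite !dot_cross_prod => Qa; apply: contra_neq Qa => e.
  have d4 := edges_cross_det cj; have d2 := edges_cross_det ck.
  move: e; rewrite /edge_param => /(canRL (divfK d4)) ->.
  by rewrite mulrAC divfK// subrr.
apply: ae_angles_all => a cj ck; apply/eqP => e; apply: Q0.
set xi := sphere_point a in cj ck e *; have xi1 : dot xi xi = 1 := dot_sphere_point a.
have cj' : edges_cross V xi j i by rewrite edges_crossC.
have ck' : edges_cross V xi k i by rewrite edges_crossC.
set r := edge_param V xi i j in e; set q := edge_param V xi j i.
set s := edge_param V xi k i.
have := edges_cross_meet xi1 cj; have := edges_cross_meet xi1 ck.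
rewrite /crossing_pt -e -/r -/q -/s => /eqP + /eqP.
rewrite eq_sym -subr_eq0 -projB => /eqP/proj_eq0; set be := dot _ _ => eb.
rewrite eq_sym -subr_eq0 -projB => /eqP/proj_eq0; set al := dot _ _ => ea.
have ab : be - al != 0.
  apply/eqP => /eqP; rewrite subr_eq0 => /eqP ab.
  have : edge_pt V j q = edge_pt V k s.
    by apply: (addIr (- edge_pt V i r)); rewrite ea eb ab.
  move/(simple_edge_pt (edges_cross_itv cj') (edges_cross_itv ck')).
  by move/(crossing_timeP cj' ck')=> [jk' _]; rewrite jk' eqxx in jk.
exists (xi + edge V i).
have -> : l1 (xi + edge V i) * l2 (xi + edge V i) -
    l3 (xi + edge V i) * l4 (xi + edge V i) = (be - al) * l2 xi * l4 xi.
  have wj : row (inord j) V - row (inord i) V =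
      al *: xi + r *: edge V i - q *: edge V j.
    by rewrite -ea /edge_pt; apply/rowP => l; rewrite !mxE; ring.
  have wk : row (inord k) V - row (inord i) V =
      be *: xi + r *: edge V i - s *: edge V k.
    by rewrite -eb /edge_pt; apply/rowP => l; rewrite !mxE; ring.
  rewrite /l1 /l2 /l3 /l4 wj wk.
  move: (edge V i) (edge V j) (edge V k) (xi) => ei ej ek x.
  by rewrite !det3E !mxE; ring.
by rewrite !mulf_neq0// ?(edges_cross_det ck) ?(edges_cross_det cj).
Qed.

Lemma ae_regular : \forall a \ae angle_measure, @angles R a ->
  regular V (sphere_point a).
Proof.
have far : \forall a \ae angle_measure, @angles R a ->
    forall i j, (i.+1 < j)%N -> forall r s, 0 <= r <= 1 -> 0 <= s <= 1 ->
      proj (sphere_point a) (edge_pt V i r) =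
      proj (sphere_point a) (edge_pt V j s) ->
      edges_cross V (sphere_point a) i j /\
      dot (edge_pt V i r - edge_pt V j s) (sphere_point a) != 0.
  apply: ae_angles_forall => i; apply: ae_angles_forall => j.
  have [ij|/negbTE ij] := boolP (i.+1 < j)%N; last exact: ae_angles_all.
  by apply: ae_angles_sub (ae_far_edges ij) => a.
have adj : \forall a \ae angle_measure, @angles R a ->
    forall i j, (i <= j <= i.+1)%N -> forall p, 0 <= p <= 1 ->
      proj (sphere_point a) (p *: edge V i + (1 - p) *: edge V j) != 0.
  apply: ae_angles_forall => i; apply: ae_angles_forall => j.
  have [ij|/negbTE ij] := boolP (i <= j <= i.+1)%N; last exact: ae_angles_all.
  by apply: ae_angles_sub (ae_adjacent_edges ij) => a.
have triple : \forall a \ae angle_measure, @angles R a ->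
    forall i j k, j != k -> edges_cross V (sphere_point a) i j ->
      edges_cross V (sphere_point a) i k ->
      edge_param V (sphere_point a) i j != edge_param V (sphere_point a) i k.
  apply: ae_angles_forall => i; apply: ae_angles_forall => j.
  apply: ae_angles_forall => k.
  have [jk|/negbTE jk] := boolP (j != k); last exact: ae_angles_all.
  by apply: ae_angles_sub (ae_no_triple_point i jk) => a.
have := ae_angles_and far (ae_angles_and adj triple).
apply: ae_angles_sub => a [afar [aadj atriple]]; split.
- by move=> i j r s ij; exact: afar.
- by move=> i j p ij; exact: aadj.
- by move=> i j k cj ck jk; exact: atriple.
Qed.

End SimplePolygon.

(** * Integrals over domains that differ by a null set *)

Section NullSets.
Local Open Scope ereal_scope.
Context d (T : measurableType d) (R : realType) (mu : {measure set T -> \bar R}).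
Implicit Types (A B N : set T) (f g : T -> \bar R).
Import HBNNSimple.

(** For functions that may fail to be measurable: the integral of a nonnegative
    function is a supremum over the simple functions below it, and these can be
    cut off on [N] without changing their integrals. *)
Lemma le_integral_off_null N f g : measurable N -> mu N = 0 ->
  (forall x, 0 <= f x) -> (forall x, 0 <= g x) ->
  (forall x, ~ N x -> f x <= g x) -> \int[mu]_x f x <= \int[mu]_x g x.
Proof.
move=> mN N0 f0 g0 fg; rewrite !ge0_integralTE//.
apply/ge_ereal_sup => _ [h /= hf <-].
have mNC : measurable (~` N) by exact: measurableC.
have -> : sintegral mu h = sintegral mu (proj_nnsfun h mNC).
  rewrite -mrestrict -(integral_nnsfun mu mNC) -{1}(patch_setT (fun=> 0%R) h).
  rewrite -(integral_nnsfun mu measurableT) -setTD.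
  apply: ge0_negligible_integral => //; last by move=> x _; rewrite lee_fin.
  by apply/measurable_EFinP; exact: measurable_funP.
apply: ereal_sup_ubound; exists (proj_nnsfun h mNC) => // x.
rewrite -mrestrict patchE; have [Nx|nNx] := pselect (N x).
  by rewrite memNset//= => /(_ Nx).
by rewrite mem_set// (le_trans (hf x))// fg.
Qed.

Lemma integral_domain_off_null A B N f : measurable N -> mu N = 0 ->
  A `\` N = B `\` N -> \int[mu]_(x in A) f x = \int[mu]_(x in B) f x.
Proof.
move=> mN N0 AB.
have ABx x : ~ N x -> (x \in A) = (x \in B).
  move=> nNx; apply/idP/idP => /set_mem h; apply/mem_set.
    by have [] : (B `\` N) x by rewrite -AB.
  by have [] : (A `\` N) x by rewrite AB.
have ge0_case g : (forall x, 0 <= g x) ->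
    \int[mu]_(x in A) g x = \int[mu]_(x in B) g x.
  move=> g0; rewrite [LHS]integral_mkcond [RHS]integral_mkcond.
  have g0' C x : 0 <= (g \_ C) x by rewrite patchE; case: ifP.
  by apply/eqP; rewrite eq_le; apply/andP; split;
    apply: (le_integral_off_null mN N0) => // x nNx; rewrite !patchE ABx.
by rewrite integralE [RHS]integralE !ge0_case.
Qed.

End NullSets.

(** * Convergence of the integrals *)

Lemma seq_continuous_within (R : realType) (X : pseudoMetricType R)
    (A : set X) (f : X -> R) (x : X) :
  (forall u : nat -> X, (forall k, A (u k)) -> u @ \oo --> x ->
    f (u k) @[k --> \oo] --> f x) ->
  f y @[y --> within A (nbhs x)] --> f x.
Proof.
move=> seqf; apply/cvgrPdist_lt => e e0; apply: contrapT => nf.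
have bad k : exists y, [/\ A y, ball x k.+1%:R^-1 y & ~ (`|f x - f y| < e)].
  apply: contrapT => nb; apply: nf.
  have k0 : 0 < k.+1%:R^-1 :> R by rewrite invr_gt0 ltr0n.
  have := nbhsx_ballx x _ k0; apply: filterS => y xy Ay.
  by apply: contrapT => fy; apply: nb; exists y.
have [u ux] := choice bad.
have cu : u @ \oo --> x.
  apply/cvg_ballP => d d0; near=> k.
  have [_ xk _] := ux k; apply: le_ball xk; apply: ltW.
  by near: k; exact: near_infty_natSinv_lt (PosNum d0).
have := seqf u (fun k => let: And3 a _ _ := ux k in a) cu.
move=> /cvgrPdist_lt /(_ e e0) [N _ /(_ N (leqnn N))] /=.
by have [_ _] := ux N.
Unshelve. all: by end_near.
Qed.

Section Integral.
Variables (R : realType) (n : nat).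
Implicit Types V : 'M[R]_(n.+2, 3).

Definition regular_angles V : set (R * R) :=
  [set a | regular V (sphere_point a)].

Let near_slice V (a : R * R) (P : 'M[R]_(n.+2, 3) * (R * R) -> Prop) :
  (\forall y \near (V, a), P y) -> \forall b \near a, P (V, b).
Proof.
move=> [[B C] /= [VB aC] BC]; apply: filterS aC => b Cb.
by apply: BC; split => //; exact: nbhs_singleton.
Qed.

(** Local constancy makes every level set open, whence measurability. *)
Lemma open_regular_level V (S : set R) : open (regular_angles V `&`
  [set a | S (edge_alternating_sum V (sphere_point a))]).
Proof.
rewrite openE => a [rega Sa].
have := near_slice (near_eq_edge_alternating_sum (z := (V, a)) rega).
have := near_slice (near_regular (z := (V, a)) rega).
by apply: filterS2 => b regb /= Sb; split=> //=; rewrite Sb.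
Qed.

Lemma measurable_regular_angles V : measurable (regular_angles V).
Proof.
have := open_measurable_prod (@open_regular_level V setT).
by rewrite (_ : [set _ | _] = setT) ?setIT//; apply/seteqP; split.
Qed.

Definition regular_integrand V : R * R -> R :=
  (fun a => edge_alternating_sum V (sphere_point a) * sin a.2)
    \_ (regular_angles V).

Lemma measurable_regular_integrand V :
  measurable_fun setT (regular_integrand V).
Proof.
rewrite (_ : regular_integrand V =
  ((fun a => edge_alternating_sum V (sphere_point a)) \_ (regular_angles V))
  \* (fun a => sin a.2)); last first.
  by apply/funext => a; rewrite /regular_integrand /= !patchE; case: ifP; rewrite ?mul0r.
apply: measurable_funM; last first.
  apply: (measurableT_comp (f := @sin R)); last exact: measurable_snd.
  by apply: continuous_measurable_fun; exact: continuous_sin.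
move=> _ Y mY; rewrite setTI.
have -> : (fun a => edge_alternating_sum V (sphere_point a)) \_ (regular_angles V)
    @^-1` Y = (regular_angles V `&`
      [set a | Y (edge_alternating_sum V (sphere_point a))]) `|`
      (~` regular_angles V `&` [set a | Y 0]).
  apply/seteqP; split=> a; rewrite /= patchE.
    by case: ifPn => [/set_mem|/negP] ra Ya; [left|right; split=> // /mem_set].
  by move=> [] [ra Ya]; [rewrite mem_set|rewrite memNset].
apply: measurableU; first exact: (open_measurable_prod (@open_regular_level V Y)).
apply: measurableI; first exact: (measurableC (@measurable_regular_angles V)).
have [Y0|nY0] := pselect (Y 0).
  by rewrite (_ : [set _ | _] = setT)//; apply/seteqP; split.
by rewrite (_ : [set _ | _] = set0)//; apply/seteqP; split.
Qed.

Lemma norm_regular_integrand V a : `|regular_integrand V a| <=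
  #|{: 'I_n.+1 * 'I_n.+1 * 'I_n.+1 * 'I_n.+1}|%:R.
Proof.
rewrite /regular_integrand patchE; case: ifP => _; last by rewrite normr0.
rewrite normrM -[leRHS]mulr1 ler_pM// ?norm_edge_alternating_sum//.
by rewrite ler_norml sin_geN1 sin_le1.
Qed.

Lemma irregular_null V : simple_open_curve (polygonal V) ->
  angle_measure (@angles R `\` regular_angles V) = 0%E.
Proof.
move=> /ae_regular [N [mN N0 DN]]; apply/eqP; rewrite -measure_le0 -N0.
apply: le_measure; rewrite ?inE//.
  by apply: measurableD; [exact: measurable_angles|exact: measurable_regular_angles].
by move=> a [Da ra]; apply: DN => /= h; apply: ra; exact: h.
Qed.

(** The complement of the generic directions is only known to lie inside a
    null set, so the change of domain must not presuppose measurability. *)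
Lemma SLL_regular_integrand V : simple_open_curve (polygonal V) ->
  SLL (polygonal V) = (8 * pi)^-1 *
    fine (\int[angle_measure]_(a in @angles R) (regular_integrand V a)%:E)%E.
Proof.
move=> simpleV; congr (_ * _); rewrite /sphere_integral /Rintegral; congr fine.
have mN : measurable (@angles R `\` regular_angles V).
  by apply: measurableD; [exact: measurable_angles|exact: measurable_regular_angles].
transitivity (\int[angle_measure]_(a in @angles R `&` regular_angles V)
    (alternating_sum (polygonal V) (sphere_point a) * sin a.2)%:E)%E.
  apply: (integral_domain_off_null _ _ (irregular_null simpleV)) => //.
  apply/seteqP; split=> a [[Da ga] na].
    by split=> //; split=> //; apply: contrapT => ra; apply: na.
  split=> //; split=> //; exact: regular_generic (dot_sphere_point a) ga.
rewrite integral_mkcondr; apply: eq_integral => a _.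
rewrite /regular_integrand !patchE; case: ifP => // /set_mem ra.
by rewrite alternating_sumE//; exact: dot_sphere_point.
Qed.

(** The sequence of values is eventually constant. *)
Lemma cvg_regular_integrand V (U : nat -> 'M[R]_(n.+2, 3)) a :
  regular_angles V a -> U @ \oo --> V ->
  (regular_integrand (U k) a)%:E @[k --> \oo] --> (regular_integrand V a)%:E.
Proof.
move=> ra cU; apply: cvg_near_cst.
have cUa : (U k, a) @[k --> \oo] --> (V, a) by exact: cvg_pair cU (cvg_cst _).
have Sk : \forall k \near \oo, edge_alternating_sum (U k) (sphere_point a) =
    edge_alternating_sum V (sphere_point a).
  exact: cUa _ (near_eq_edge_alternating_sum (z := (V, a)) ra).
have rk : \forall k \near \oo, regular (U k) (sphere_point a).
  exact: cUa _ (near_regular (z := (V, a)) ra).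
move: Sk rk; apply: filterS2 => k Sk rk.
by rewrite /regular_integrand !patchE !mem_set// Sk.
Qed.

Lemma finite_measure_angles : (angle_measure (@angles R) < +oo)%E.
Proof.
rewrite product_measure1E; [|exact: measurable_itv|exact: measurable_itv].
apply: lte_mul_pinfty => //; last first.
  by apply: compact_finite_measure; exact: segment_compact.
rewrite ge0_fin_numE//; apply: compact_finite_measure; exact: segment_compact.
Qed.

Lemma cvg_integral_regular V (U : nat -> 'M[R]_(n.+2, 3)) :
  simple_open_curve (polygonal V) -> U @ \oo --> V ->
  fine (\int[angle_measure]_(a in @angles R) (regular_integrand (U k) a)%:E)%E
    @[k --> \oo] -->
  fine (\int[angle_measure]_(a in @angles R) (regular_integrand V a)%:E)%E.
Proof.
move=> simpleV cU; pose M : R := #|{: 'I_n.+1 * 'I_n.+1 * 'I_n.+1 * 'I_n.+1}|%:R.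
have mg W : measurable_fun (@angles R) (EFin \o regular_integrand W).
  apply/measurable_EFinP; apply: measurable_funS (measurable_regular_integrand W) => //.
have iM : (angle_measure).-integrable (@angles R) (cst M%:E).
  apply/integrableP; split; first exact: measurable_cst.
  have -> : (fun a : R * R => `|cst M%:E a|)%E = cst `|M|%:E by [].
  rewrite integral_cst; last exact: measurable_angles.
  by apply: lte_mul_pinfty => //; rewrite finite_measure_angles.
have cv : \forall a \ae angle_measure, @angles R a ->
    (regular_integrand (U k) a)%:E @[k --> \oo] --> (regular_integrand V a)%:E.
  apply: ae_angles_sub (ae_regular simpleV) => a ra.
  exact: cvg_regular_integrand.
have bd : \forall a \ae angle_measure, forall k, @angles R a ->
    (`|(regular_integrand (U k) a)%:E| <= M%:E)%E.
  by apply: aeW => a k _; rewrite lee_fin norm_regular_integrand.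
have [iV _ cI] := dominated_convergence
  (mu := (@lebesgue_measure R \x @lebesgue_measure R)%E) (@measurable_angles R)
  (fun k => mg (U k)) (mg V) cv iM bd.
apply: fine_cvg; rewrite fineK; first exact: cI.
by apply: integrable_fin_num => //; exact: measurable_angles.
Qed.

End Integral.

Unset Implicit Arguments.

Theorem proposition6p2 (R : realType) (n : nat) :
  {within [set V : 'M[R]_(n.+2, 3) | simple_open_curve (polygonal V)],
    continuous (fun V : 'M[R]_(n.+2, 3) => SLL (polygonal V))}.
Proof.
apply/subspace_continuousP => V /= simpleV.
apply: seq_continuous_within => U simpleU cU.
rewrite SLL_regular_integrand//.
rewrite (_ : (fun k => _) = fun k => (8 * pi)^-1 * fine
    (\int[angle_measure]_(a in @angles R) (regular_integrand (U k) a)%:E)%E).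
  by apply: cvgM; [exact: cvg_cst|exact: cvg_integral_regular].
by apply/funext => k; apply: SLL_regular_integrand; exact: simpleU.
Qed.
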